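(* Let $d\in\mathbb{N}$ and let $G\subset\mathbb{R}^d$ be a convex symmetric body in the isotropic position with isotropic constant $L=L(G)$. Let $m^G(\xi)=\int_G e^{2\pi i\langle x,\xi\rangle}\,{\rm d}x$ for $\xi\in\mathbb{R}^d$. Then for every $\xi\in\mathbb{R}^d\setminus\{0\}$, $$|m^G(\xi)|\le 150\,(L|\xi|)^{-1},\qquad |m^G(\xi)-1|\le 150\,L|\xi|,$$ and $$|\langle \xi,\nabla m^G(\xi)\rangle|\le 150.$$
   Context: A convex symmetric body in $\mathbb{R}^d$ is a bounded, closed, convex set with non-empty interior such that $G=-G$. $G$ is in the isotropic position if $|G|=1$ and there is $L=L(G)>0$ (the isotropic constant) with $\int_G\langle x,\xi\rangle^2\,{\rm d}x=L^2|\xi|^2$ for all $\xi\in\mathbb{R}^d$. $|\xi|$ is the Euclidean norm. *)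

(* Defs.v *)
(* classical reals. Points of R^d are encoded as functions
   nat -> R whose coordinates of index >= d vanish (predicate [inRd d]). *)
From Stdlib Require Import Reals Lra Lia ClassicalEpsilon.
Open Scope R_scope.

Fixpoint rsum (n : nat) (f : nat -> R) : R :=
  match n with O => 0 | S n' => rsum n' f + f n' end.

Definition vec := nat -> R.

Definition inRd (d : nat) (x : vec) : Prop := forall i, (d <= i)%nat -> x i = 0.

Definition zero_vec : vec := fun _ => 0.

Definition dot (d : nat) (x y : vec) : R := rsum d (fun i => x i * y i).

Definition enorm (d : nat) (x : vec) : R := sqrt (dot d x x).

Definition upd (x : vec) (n : nat) (v : R) : vec :=
  fun i => if Nat.eqb i n then v else x i.

Definition convex_symmetric_body (d : nat) (G : vec -> Prop) : Prop :=
  (forall x, G x -> inRd d x) /\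
  (exists R0, forall x, G x -> enorm d x <= R0) /\
  (forall (xs : nat -> vec) (y : vec),
      (forall n, G (xs n)) -> (forall i, Un_cv (fun n => xs n i) (y i)) -> G y) /\
  (forall x y t, G x -> G y -> 0 <= t <= 1 ->
      G (fun i => t * x i + (1 - t) * y i)) /\
  (exists x r, 0 < r /\
      forall y, inRd d y -> enorm d (fun i => y i - x i) < r -> G y) /\
  (forall x, G x -> G (fun i => - x i)).

(* ---- Riemann integral over R^d (for bounded, compactly supported f) ----
   Riemann sums on the grid (2^-k Z)^d restricted to the cube [-2^k,2^k]^d;
   for compactly supported Riemann integrable functions (e.g. indicator of a
   convex body times a continuous function) they converge to the integral,
   which coincides with the Lebesgue integral. *)

Fixpoint sum_box (n M : nat) (F : vec -> R) : R :=
  match n with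
  | O => F zero_vec
  | S n' => sum_f_R0 (fun t =>
              sum_box n' M (fun x => F (upd x n' (INR t - INR M)))) (2 * M)
  end.

Definition grid_sum (d : nat) (k : nat) (f : vec -> R) : R :=
  let h := / 2 ^ k in
  h ^ d * sum_box d (4 ^ k) (fun j => f (fun i => h * j i)).

Definition Rd_integral (d : nat) (f : vec -> R) (l : R) : Prop :=
  Un_cv (fun k => grid_sum d k f) l.

(* the value of the integral (meaningful whenever it exists) *)
Definition Rd_int (d : nat) (f : vec -> R) : R :=
  epsilon (inhabits 0) (fun l => Rd_integral d f l).

Definition ind (G : vec -> Prop) (x : vec) : R :=
  if excluded_middle_informative (G x) then 1 else 0.

Definition isotropic (d : nat) (G : vec -> Prop) (L : R) : Prop :=
  Rd_integral d (ind G) 1 /\ 0 < L /\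
  forall xi, inRd d xi ->
    Rd_integral d (fun x => ind G x * (dot d x xi) ^ 2) (L ^ 2 * (enorm d xi) ^ 2).

Definition mG_re (d : nat) (G : vec -> Prop) (xi : vec) : R :=
  Rd_int d (fun x => ind G x * cos (2 * PI * dot d x xi)).
Definition mG_im (d : nat) (G : vec -> Prop) (xi : vec) : R :=
  Rd_int d (fun x => ind G x * sin (2 * PI * dot d x xi)).

Definition cmod (a b : R) : R := sqrt (a ^ 2 + b ^ 2).

(* Main.v *)
(** The law of [<x, xi>] for [x] uniform in [G] has an even log-concave density, of
    standard deviation [sg = L |xi|]. Its maximum [M] is at 0 and is at most a constant
    over [sg]: if the density at [sg/3] were below [M/4], log-concavity would make the
    tails decay geometrically at scale [sg/3], and the second moment would be less than
    [sg^2]. Summation by parts against [cos] then gives [M]-times-a-constant decay of the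
    transform, and against [s sin s] a bound by the total mass, because a density that
    decreases away from 0 satisfies [\int |s f'(s)| ds = 1]. The estimate of [m - 1] only uses
    [1 - cos (2 PI s) <= 2 PI |s| <= PI (s^2 / sg + sg)].

    The density itself is replaced by the volumes of the slabs of [G] of a small width,
    and their log-concavity is the Brunn-Minkowski inequality. It comes from
    Prékopa-Leindler for the iterated grid sums, by induction on the dimension; the same
    induction shows that grid sums of log-concave functions converge, since a
    quasi-concave function on the line has Riemann sums with error (bound * step). *)
From Stdlib Require Import Reals Lra Lia FunctionalExtensionality ClassicalEpsilon.
Require Import Defs.
Open Scope R_scope.

(** * Riemann sums of quasi-concave functions *)

(** The integral of the statement is a limit of sums over coordinate grids, while the slabs are
    orthogonal to an arbitrary [xi]. No rotation or change of variables relates the two, so the law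
    of the linear form is never obtained by Fubini in the direction [xi]: each slab is a convex set
    of full dimension with its own grid volume, and only Brunn-Minkowski compares different slabs.
    Convexity is thus used twice, for the existence of the volumes and for their shape.

    The test functions [cos] and [s sin s] are not log-concave. Their integrals over half of [G] are
    squeezed between step functions constant on slabs, with an error proportional to the slab width;
    the hyperplane shared by the two halves needs its own correction.

    Differentiability of the transform is given by the third claim itself, so only the value of the
    radial derivative has to be identified.

    The three bounds obtained are 25 = 24 + 1 (the 1 pays for discretisation), 8 >= 2 PI and 33 >= 2
    (4 PI + 1/2), all below 150. *)

Ltac push_INR :=
  repeat first [rewrite S_INR | rewrite plus_INR | rewrite mult_INR
               | rewrite minus_INR by lia];
  change (INR 0) with 0.

Lemma rsum_ext n f g : (forall i, (i < n)%nat -> f i = g i) -> rsum n f = rsum n g.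
Proof.
  induction n as [|n IH]; intros E; simpl; [reflexivity|].
  rewrite IH, E; auto.
Qed.

Lemma rsum_le n f g : (forall i, (i < n)%nat -> f i <= g i) -> rsum n f <= rsum n g.
Proof.
  induction n as [|n IH]; intros E; simpl; [lra|].
  apply Rplus_le_compat; auto.
Qed.

Lemma rsum_const n c : rsum n (fun _ => c) = INR n * c.
Proof.
  induction n as [|n IH]; [simpl; ring|].
  rewrite S_INR; simpl; rewrite IH; ring.
Qed.

Lemma rsum_zero n f : (forall i, (i < n)%nat -> f i = 0) -> rsum n f = 0.
Proof.
  intros E; rewrite (rsum_ext n f (fun _ => 0)) by exact E.
  rewrite rsum_const; ring.
Qed.

Lemma rsum_nonneg n f : (forall i, (i < n)%nat -> 0 <= f i) -> 0 <= rsum n f.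
Proof.
  intros E; rewrite <- (rsum_zero n (fun _ => 0)) by auto.
  apply rsum_le; auto.
Qed.

Lemma rsum_plus n f g : rsum n (fun i => f i + g i) = rsum n f + rsum n g.
Proof. induction n as [|n IH]; simpl; [ring|rewrite IH; ring]. Qed.

Lemma rsum_scal n c f : rsum n (fun i => c * f i) = c * rsum n f.
Proof. induction n as [|n IH]; simpl; [ring|rewrite IH; ring]. Qed.

Lemma rsum_shift n f : rsum (S n) f = f 0%nat + rsum n (fun i => f (S i)).
Proof.
  induction n as [|n IH]; [simpl; ring|].
  change (rsum (S n) f + f (S n) = f 0%nat + (rsum n (fun i => f (S i)) + f (S n))).
  rewrite IH; ring.
Qed.

Lemma rsum_app n m f : rsum (n + m) f = rsum n f + rsum m (fun i => f (n + i)%nat).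
Proof.
  induction m as [|m IH].
  - rewrite Nat.add_0_r; simpl; ring.
  - rewrite Nat.add_succ_r; simpl; rewrite IH; ring.
Qed.

Lemma rsum_rev n f : rsum n f = rsum n (fun i => f (n - 1 - i)%nat).
Proof.
  induction n as [|n IH]; [reflexivity|].
  rewrite (rsum_shift n (fun i => f (S n - 1 - i)%nat)).
  change (rsum (S n) f) with (rsum n f + f n).
  rewrite IH.
  replace (S n - 1 - 0)%nat with n by lia.
  rewrite (rsum_ext n (fun i => f (S n - 1 - S i)%nat) (fun i => f (n - 1 - i)%nat)); [ring|].
  intros i Hi; f_equal; lia.
Qed.

Lemma rsum_split_at n p f : (p < n)%nat ->
  rsum n f = rsum p (fun i => f (p - 1 - i)%nat) + f p
             + rsum (n - p - 1) (fun i => f (p + 1 + i)%nat).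
Proof.
  intros Hp.
  replace n with (p + 1 + (n - p - 1))%nat at 1 by lia.
  rewrite rsum_app, rsum_app, (rsum_rev p f); simpl.
  rewrite Nat.add_0_r; ring.
Qed.

Lemma rsum_abs n f : Rabs (rsum n f) <= rsum n (fun i => Rabs (f i)).
Proof.
  induction n as [|n IH]; simpl; [rewrite Rabs_R0; lra|].
  eapply Rle_trans; [apply Rabs_triang|lra].
Qed.

Lemma rsum_argmax n f : (0 < n)%nat ->
  exists p, (p < n)%nat /\ forall i, (i < n)%nat -> f i <= f p.
Proof.
  induction n as [|n IH]; [lia|intros _].
  destruct n as [|n].
  - exists 0%nat; split; [lia|]; intros i Hi.
    replace i with 0%nat by lia; lra.
  - destruct IH as [p [Hp Hm]]; [lia|].
    destruct (Rle_dec (f p) (f (S n))) as [Hle|Hle].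
    + exists (S n); split; [lia|]; intros i Hi.
      destruct (Nat.eq_dec i (S n)) as [->|Hne]; [lra|].
      specialize (Hm i ltac:(lia)); lra.
    + exists p; split; [lia|]; intros i Hi.
      destruct (Nat.eq_dec i (S n)) as [->|Hne]; [lra|].
      apply Hm; lia.
Qed.

Definition qconc (f : R -> R) : Prop :=
  forall x y z, x <= y <= z -> Rmin (f x) (f z) <= f y.

(* Both sides are sums over a partition cut at the current point [c]: the next
   points of the two grids lie at distance [r] and [s] from [c].  Advancing [c] to
   the nearer one never increases the left side minus the right side. *)
Lemma lower_sum_le_upper_sum (phi : R -> R) h eta : 0 < h -> 0 < eta ->
  (forall x, 0 <= phi x) ->
  forall N m n c r s, (m + n <= N)%nat -> 0 <= r -> 0 <= s ->
  (forall x y, c <= x <= y -> phi y <= phi x) ->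
  (forall x, c + s + eta * INR n <= x -> phi x = 0) ->
  r * phi (c + r) + h * rsum m (fun i => phi (c + r + h * INR (S i)))
  <= s * phi c + eta * rsum n (fun j => phi (c + s + eta * INR j)).
Proof.
  intros Hh He H0 N.
  induction N as [|N IH]; intros m n c r s HN Hr Hs Hd Hz;
    (destruct (Rle_dec r s) as [Hrs|Hrs];
     [ destruct m as [|m] | destruct n as [|n] ]); try lia.
  (* The walk ends in two ways. With no sample of the [h]-grid left, [r <= s] and monotonicity
     suffice. With no sample of the [eta]-grid left, the point [c + r] and all later ones lie beyond
     the support. *)
  1,3: assert (H1 : phi (c + r) <= phi c) by (apply Hd; lra);
    assert (H2 : 0 <= rsum n (fun j => phi (c + s + eta * INR j)))
      by (apply rsum_nonneg; auto);
    simpl rsum at 1; pose proof (H0 c); pose proof (H0 (c + r));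
    assert (0 <= eta * rsum n (fun j => phi (c + s + eta * INR j))) by nra; nra.
  - rewrite (Hz (c + r)) by (simpl INR; lra).
    rewrite (rsum_zero m).
    2:{ intros i _; apply Hz; simpl INR at 1; pose proof (pos_INR (S i)); nra. }
    simpl; pose proof (H0 c); nra.
  - rewrite rsum_shift.
    specialize (IH m n (c + r) h (s - r)).
    assert (E1 : rsum m (fun i => phi (c + r + h + h * INR (S i)))
                 = rsum m (fun i => phi (c + r + h * INR (S (S i))))).
    { apply rsum_ext; intros i _; f_equal; rewrite (S_INR (S i)); ring. }
    assert (E2 : rsum n (fun j => phi (c + r + (s - r) + eta * INR j))
                 = rsum n (fun j => phi (c + s + eta * INR j))).
    { apply rsum_ext; intros i _; f_equal; ring. }
    rewrite E1, E2 in IH.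
    assert (H1 : phi (c + r) <= phi c) by (apply Hd; lra).
    replace (c + r + h * INR 1) with (c + r + h) by (simpl; ring).
    assert (IH' := IH ltac:(lia) ltac:(lra) ltac:(lra)
       ltac:(intros; apply Hd; lra)
       ltac:(intros x Hx; apply Hz; lra)).
    pose proof (H0 (c + r)); nra.
  - rewrite (Hz (c + r)) by (simpl INR; lra).
    rewrite (rsum_zero m).
    2:{ intros i _; apply Hz; simpl INR at 1; pose proof (pos_INR (S i)); nra. }
    simpl; pose proof (H0 c); nra.
  - rewrite (rsum_shift n).
    specialize (IH m n (c + s) (r - s) eta).
    assert (E1 : rsum m (fun i => phi (c + s + (r - s) + h * INR (S i)))
                 = rsum m (fun i => phi (c + r + h * INR (S i)))).
    { apply rsum_ext; intros i _; f_equal; ring. }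
    assert (E2 : rsum n (fun j => phi (c + s + eta + eta * INR j))
                 = rsum n (fun j => phi (c + s + eta * INR (S j)))).
    { apply rsum_ext; intros i _; f_equal; rewrite S_INR; ring. }
    rewrite E1, E2 in IH.
    replace (c + s + (r - s)) with (c + r) in IH by ring.
    replace (c + s + eta * INR 0) with (c + s) by (simpl; ring).
    assert (H1 : phi (c + r) <= phi c) by (apply Hd; lra).
    assert (IH' := IH ltac:(lia) ltac:(lra) ltac:(lra)
       ltac:(intros; apply Hd; lra)
       ltac:(intros x Hx; apply Hz; rewrite S_INR; lra)).
    nra.
Qed.

(** Step, origin and number of samples are all free because Prékopa-Leindler compares grids of
    different steps. *)
Definition apsum (h al : R) (n : nat) (phi : R -> R) : R :=
  h * rsum n (fun t => phi (al + h * INR t)).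

Lemma grid_cell n be eta a : 0 < eta -> be <= a < be + eta * INR n ->
  exists u, (u < n)%nat /\ be + eta * INR u <= a < be + eta * INR (S u).
Proof.
  intros He; induction n as [|n IH]; intros Ha.
  - simpl in Ha; lra.
  - destruct (Rlt_dec a (be + eta * INR n)) as [Hl|Hl].
    + destruct IH as [u [Hu Hb]]; [lra|]; exists u; split; [lia|exact Hb].
    + exists n; split; [lia|lra].
Qed.

(** Cut both grids at the largest sample [a] of the first one and compare the two monotone halves
    with [lower_sum_le_upper_sum]. The sample at [a] costs at most [B * h]; the two pieces of the
    [eta]-cell around [a] together cost at most [B * eta]. Used in both directions, this shows that
    the sums on any two fine grids are close. *)
Lemma apsum_compare f B h eta al be n n' :
  qconc f -> (forall x, 0 <= f x <= B) -> 0 < h -> 0 < eta ->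
  (forall x, f x <> 0 -> be <= x < be + eta * INR n') ->
  apsum h al n f <= apsum eta be n' f + B * (h + eta).
Proof.
  intros Hq Hb Hh He Hs; unfold apsum.
  assert (HB : 0 <= B) by (pose proof (Hb 0); lra).
  assert (Hpos : 0 <= rsum n' (fun t => f (be + eta * INR t)))
    by (apply rsum_nonneg; intros; apply Hb).
  destruct n as [|n]; [simpl; nra|].
  destruct (rsum_argmax (S n) (fun t => f (al + h * INR t)) ltac:(lia)) as [p [Hp Hm]].
  cbv beta in Hm.
  set (a := al + h * INR p) in *.
  destruct (Req_dec (f a) 0) as [Hz|Hz].
  { rewrite (rsum_zero (S n)); [nra|].
    intros i Hi; specialize (Hm i Hi); pose proof (Hb (al + h * INR i)); lra. }
  destruct (grid_cell n' be eta a He (Hs a Hz)) as [u [Hu [Hu1 Hu2]]].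
  set (M := f a) in *.
  assert (HM : 0 <= M <= B) by apply Hb.
  (* [a] maximises [f] only among grid points. Truncating at [M = f a] makes the function monotone
     on each side of [a], and leaves the samples of the first grid unchanged. *)
  assert (Rt := lower_sum_le_upper_sum (fun x => Rmin (f x) M) h eta Hh He
    ltac:(intros x; apply Rmin_glb; [apply Hb|lra])
    _ (S n - p - 1)%nat (n' - u - 1)%nat a 0 (be + eta * INR (S u) - a)
    (le_n _) ltac:(lra) ltac:(lra)).
  assert (Lt := lower_sum_le_upper_sum (fun x => Rmin (f (- x)) M) h eta Hh He
    ltac:(intros x; apply Rmin_glb; [apply Hb|lra])
    _ p (S u)%nat (- a) 0 (a - (be + eta * INR u))
    (le_n _) ltac:(lra) ltac:(lra)).
  assert (Rt' := Rt
    ltac:(intros x y Hxy; apply Rmin_glb; [|apply Rmin_r];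
          rewrite Rmin_comm; apply Hq; lra)
    ltac:(intros x Hx; destruct (Req_dec (f x) 0) as [E|E];
          [rewrite E; apply Rmin_left; lra|
           exfalso; destruct (Hs x E) as [_ Hx2];
           replace (n' - u - 1)%nat with (n' - S u)%nat in Hx by lia;
           rewrite minus_INR in Hx by lia; lra])).
  assert (Lt' := Lt
    ltac:(intros x y Hxy; apply Rmin_glb; [|apply Rmin_r];
          apply Hq; lra)
    ltac:(intros x Hx; destruct (Req_dec (f (- x)) 0) as [E|E];
          [rewrite E; apply Rmin_left; lra|
           exfalso; destruct (Hs (- x) E) as [Hx1 _]; rewrite S_INR in Hx; nra])).
  clear Rt Lt; cbv beta in Rt', Lt'.
  rewrite (rsum_split_at (S n) p) by lia.
  fold a; fold M.
  rewrite (rsum_ext p _ (fun i => Rmin (f (- (- a + 0 + h * INR (S i)))) M)).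
  2:{ intros i Hi.
      replace (- (- a + 0 + h * INR (S i))) with (al + h * INR (p - 1 - i)).
      - symmetry; apply Rmin_left; apply Hm; lia.
      - unfold a; push_INR; ring. }
  rewrite (rsum_ext (S n - p - 1) _ (fun i => Rmin (f (a + 0 + h * INR (S i))) M)).
  2:{ intros i Hi.
      replace (a + 0 + h * INR (S i)) with (al + h * INR (p + 1 + i)).
      - symmetry; apply Rmin_left; apply Hm; lia.
      - unfold a; push_INR; ring. }
  assert (Y : rsum n' (fun t => f (be + eta * INR t))
    = rsum (S u) (fun j => f (- (- a + (a - (be + eta * INR u)) + eta * INR j)))
      + rsum (n' - u - 1) (fun j => f (a + (be + eta * INR (S u) - a) + eta * INR j))).
  { replace n' with (S u + (n' - u - 1))%nat at 1 by lia.
    rewrite rsum_app, (rsum_rev (S u)); f_equal; apply rsum_ext; intros i Hi; f_equal.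
    - push_INR; ring.
    - push_INR; ring. }
  rewrite Y.
  assert (Z1 : rsum (S u) (fun j => Rmin (f (- (- a + (a - (be + eta * INR u)) + eta * INR j))) M)
    <= rsum (S u) (fun j => f (- (- a + (a - (be + eta * INR u)) + eta * INR j))))
    by (apply rsum_le; intros; apply Rmin_l).
  assert (Z2 : rsum (n' - u - 1) (fun j => Rmin (f (a + (be + eta * INR (S u) - a) + eta * INR j)) M)
    <= rsum (n' - u - 1) (fun j => f (a + (be + eta * INR (S u) - a) + eta * INR j)))
    by (apply rsum_le; intros; apply Rmin_l).
  replace (f (- - a)) with M in Lt' by (unfold M; f_equal; ring).
  fold M in Rt'.
  rewrite (Rmin_left M M) in Rt', Lt' by lra.
  rewrite S_INR in Rt', Hu2 |- *.
  rewrite S_INR in Z2.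
  apply (Rmult_le_compat_l eta) in Z1; [|lra].
  apply (Rmult_le_compat_l eta) in Z2; [|lra].
  assert (M * (h + eta) <= B * (h + eta)) by nra.
  lra.
Qed.

(** * The one-dimensional Prékopa–Leindler inequality *)

Lemma Un_cv_le u v a b K : (forall k, (K <= k)%nat -> u k <= v k) ->
  Un_cv u a -> Un_cv v b -> a <= b.
Proof.
  intros Hle Hu Hv; destruct (Rle_dec a b) as [|Hn]; [assumption|exfalso].
  destruct (Hu ((a - b) / 2) ltac:(lra)) as [N1 H1].
  destruct (Hv ((a - b) / 2) ltac:(lra)) as [N2 H2].
  set (k := (N1 + N2 + K)%nat).
  specialize (H1 k ltac:(lia)); specialize (H2 k ltac:(lia)).
  specialize (Hle k ltac:(lia)).
  unfold Rdist in *; apply Rabs_def2 in H1; apply Rabs_def2 in H2; lra.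
Qed.

Lemma Un_cv_const c : Un_cv (fun _ => c) c.
Proof. intros e He; exists 0%nat; intros; rewrite Rdist_eq; lra. Qed.

Lemma Un_cv_ext u v a : (forall k, u k = v k) -> Un_cv u a -> Un_cv v a.
Proof. intros E; replace v with u; [auto|]; extensionality k; apply E. Qed.

Lemma pow2_pos k : 0 < 2 ^ k.
Proof. apply pow_lt; lra. Qed.

Lemma inv_pow2_pos k : 0 < / 2 ^ k.
Proof. apply Rinv_0_lt_compat, pow2_pos. Qed.

Lemma pow2_large A : exists K, forall k, (K <= k)%nat -> A < 2 ^ k.
Proof.
  destruct (INR_unbounded A) as [N HN]; exists N; intros k Hk.
  assert (H : forall j, INR j < 2 ^ j).
  { induction j as [|j IH]; [simpl; lra|]; rewrite S_INR; simpl.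
    assert (1 <= 2 ^ j) by (apply pow_R1_Rle; lra); lra. }
  specialize (H k); apply le_INR in Hk; lra.
Qed.

Lemma inv_pow2_cv c : Un_cv (fun k => c * / 2 ^ k) 0.
Proof.
  intros e He; destruct (pow2_large (Rabs c / e)) as [K HK]; exists K; intros k Hk.
  unfold Rdist; rewrite Rminus_0_r, Rabs_mult, (Rabs_pos_eq (/ 2 ^ k))
    by (left; apply inv_pow2_pos).
  specialize (HK k Hk).
  apply Rmult_lt_reg_r with (2 ^ k); [apply pow2_pos|].
  rewrite Rmult_assoc, Rinv_l by (pose proof (pow2_pos k); lra).
  apply (Rmult_lt_compat_r e) in HK; [|assumption].
  unfold Rdiv in HK; rewrite Rmult_assoc, Rinv_l in HK by lra; lra.
Qed.

Lemma pow4_INR k : INR (4 ^ k) = 2 ^ k * 2 ^ k.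
Proof.
  rewrite pow_INR; rewrite <- Rpow_mult_distr; f_equal; simpl; ring.
Qed.

Lemma Rabs_bounds x a : Rabs x <= a -> - a <= x <= a.
Proof. intros H; pose proof (Rle_abs x); pose proof (Rle_abs (- x)); rewrite Rabs_Ropp in *; lra. Qed.

Lemma approx_limit u a c K :
  (forall k l, (K <= k)%nat -> (K <= l)%nat ->
     Rabs (u k - u l) <= c * (/ 2 ^ k + / 2 ^ l)) ->
  Un_cv u a -> forall k, (K <= k)%nat -> Rabs (u k - a) <= c * / 2 ^ k.
Proof.
  intros H Ha k Hk.
  assert (Hc := CV_plus _ _ _ _ (Un_cv_const (c * / 2 ^ k)) (inv_pow2_cv c)).
  rewrite Rplus_0_r in Hc.
  apply Rabs_le; split.
  - apply Ropp_le_cancel; rewrite Ropp_involutive.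
    apply (Un_cv_le (fun l => u l - u k) (fun l => c * / 2 ^ k + c * / 2 ^ l) _ _ K).
    + intros l Hl; specialize (H k l Hk Hl).
      apply Rabs_bounds in H; lra.
    + replace (- (u k - a)) with (a - u k) by ring.
      apply CV_minus; [exact Ha|apply Un_cv_const].
    + exact Hc.
  - apply (Un_cv_le (fun l => u k - u l) (fun l => c * / 2 ^ k + c * / 2 ^ l) _ _ K).
    + intros l Hl; specialize (H k l Hk Hl).
      apply Rabs_bounds in H; lra.
    + apply CV_minus; [apply Un_cv_const|exact Ha].
    + exact Hc.
Qed.

Lemma rate_Cauchy_cv u c K :
  (forall k l, (K <= k)%nat -> (K <= l)%nat ->
     Rabs (u k - u l) <= c * (/ 2 ^ k + / 2 ^ l)) ->
  exists a, Un_cv u a.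
Proof.
  intros H; destruct (R_complete u) as [a Ha]; [|exists a; exact Ha].
  intros e He; destruct (inv_pow2_cv c (e / 2) ltac:(lra)) as [N HN].
  exists (N + K)%nat; intros n m Hn Hm.
  pose proof (HN n ltac:(lia)) as H1; pose proof (HN m ltac:(lia)) as H2.
  unfold Rdist in *; rewrite Rminus_0_r in H1, H2.
  apply Rabs_def2 in H1; apply Rabs_def2 in H2.
  specialize (H n m ltac:(lia) ltac:(lia)); lra.
Qed.

(** The weighted geometric mean a^l b^(1-l) of positive numbers. At a zero argument [ln] returns 0
    and the formula no longer gives this mean, so log-concavity and all inequalities below are
    stated for positive values only. *)
Definition gmean (l a b : R) : R := exp (l * ln a + (1 - l) * ln b).

Lemma gmean_pos l a b : 0 < gmean l a b.
Proof. apply exp_pos. Qed.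

Lemma gmean_mult l a b c d : 0 < a -> 0 < b -> 0 < c -> 0 < d ->
  gmean l (a * c) (b * d) = gmean l a b * gmean l c d.
Proof.
  intros; unfold gmean; rewrite !ln_mult, <- exp_plus by assumption; f_equal; ring.
Qed.

Lemma gmean_diag l a : 0 < a -> gmean l a a = a.
Proof.
  intros H; unfold gmean; replace (l * ln a + (1 - l) * ln a) with (ln a) by ring.
  apply exp_ln, H.
Qed.

Lemma exp_le_compat x y : x <= y -> exp x <= exp y.
Proof. intros [H|H]; [left; apply exp_increasing, H|right; f_equal; exact H]. Qed.

Lemma ln_le_compat x y : 0 < x -> x <= y -> ln x <= ln y.
Proof. intros Hx [H|H]; [left; apply ln_increasing; assumption|right; f_equal; exact H]. Qed.

Lemma gmean_mono l a b c d : 0 < l < 1 -> 0 < a <= c -> 0 < b <= d ->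
  gmean l a b <= gmean l c d.
Proof.
  intros Hl Ha Hb; apply exp_le_compat.
  assert (ln a <= ln c) by (apply ln_le_compat; lra).
  assert (ln b <= ln d) by (apply ln_le_compat; lra); nra.
Qed.

Lemma gmean_min l a b : 0 < l < 1 -> 0 < a -> 0 < b -> Rmin a b <= gmean l a b.
Proof.
  intros Hl Ha Hb.
  assert (H : 0 < Rmin a b) by (apply Rmin_glb_lt; assumption).
  rewrite <- (gmean_diag l (Rmin a b)) at 1 by assumption.
  apply gmean_mono; [assumption| |]; split; auto using Rmin_l, Rmin_r.
Qed.

(** The tangent line of [exp] at the mean [m] of the logarithms lies below [exp]; averaging its
    values at [ln a] and [ln b] cancels the linear term. *)
Lemma gmean_amgm l a b : 0 < l < 1 -> 0 < a -> 0 < b ->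
  gmean l a b <= l * a + (1 - l) * b.
Proof.
  intros Hl Ha Hb; unfold gmean; set (m := l * ln a + (1 - l) * ln b).
  assert (H : forall c, 0 < c -> exp m * (1 + (ln c - m)) <= c).
  { intros c Hc; rewrite <- (exp_ln c Hc) at 2.
    replace (ln c) with (m + (ln c - m)) at 2 by ring; rewrite exp_plus.
    apply Rmult_le_compat_l; [left; apply exp_pos|].
    destruct (Req_dec (ln c - m) 0) as [->|Hne]; [rewrite exp_0; lra|].
    left; apply exp_ineq1, Hne. }
  pose proof (H a Ha) as H1; pose proof (H b Hb) as H2.
  apply (Rmult_le_compat_l l) in H1; [|lra].
  apply (Rmult_le_compat_l (1 - l)) in H2; [|lra].
  replace (exp m) with (l * (exp m * (1 + (ln a - m)))
    + (1 - l) * (exp m * (1 + (ln b - m)))) at 1; [lra|].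
  unfold m; ring.
Qed.

(** * Merging two unimodal sequences *)

Lemma chain_le (a : nat -> R) m : (forall i, (i < m)%nat -> a (S i) <= a i) ->
  forall i, (i <= m)%nat -> a i <= a 0%nat.
Proof.
  intros H; induction i as [|i IH]; intros Hi; [lra|].
  specialize (H i ltac:(lia)); specialize (IH ltac:(lia)); lra.
Qed.

(* Walk from the common maximum, always stepping to the larger of the two next values;
   each value is met once, and at that moment the other coordinate is at least as large. *)
Lemma half_merge (a b H : nat -> R) : a 0%nat = b 0%nat ->
  forall N m n, (m + n <= N)%nat ->
  (forall i, (i < m)%nat -> a (S i) <= a i) ->
  (forall j, (j < n)%nat -> b (S j) <= b j) ->
  (forall i j, (i <= m)%nat -> (j <= n)%nat -> Rmin (a i) (b j) <= H (i + j)%nat) ->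
  rsum m (fun i => a (S i)) + rsum n (fun j => b (S j)) <= rsum (m + n) (fun k => H (S k)).
Proof.
  intros E; induction N as [|N IH]; intros m n HN Ha Hb HH.
  - replace m with 0%nat by lia; replace n with 0%nat by lia; simpl; lra.
  - assert (Ca := chain_le a m Ha); assert (Cb := chain_le b n Hb).
    (* The walk is read backwards: the smaller of the two last values is removed and charged to
       [H (m + n)]. If one sequence is exhausted, the common starting value shows that the other one
       holds the smaller value. *)
    assert (D : ((0 < m)%nat /\ a m <= b n) \/ ((0 < n)%nat /\ b n <= a m)
                \/ (m = 0 /\ n = 0)%nat).
    { destruct m as [|m]; destruct n as [|n]; auto.
      - right; left; split; [lia|]; rewrite E; apply Cb; lia.
      - left; split; [lia|]; rewrite <- E; apply Ca; lia.
      - destruct (Rle_dec (a (S m)) (b (S n))); [left|right; left]; split; lia || lra. }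
    destruct D as [[Hm D]|[[Hn D]|[-> ->]]]; [| |simpl; lra].
    + destruct m as [|m]; [lia|].
      assert (P := IH m n ltac:(lia) ltac:(intros; apply Ha; lia) Hb
        ltac:(intros; apply HH; lia)).
      assert (Q := HH (S m) n ltac:(lia) ltac:(lia)).
      rewrite Rmin_left in Q by exact D; simpl in Q |- *; lra.
    + destruct n as [|n]; [lia|].
      assert (P := IH m n ltac:(lia) Ha ltac:(intros; apply Hb; lia)
        ltac:(intros; apply HH; lia)).
      assert (Q := HH m (S n) ltac:(lia) ltac:(lia)).
      rewrite Rmin_right in Q by exact D.
      rewrite Nat.add_succ_r in Q |- *; simpl; lra.
Qed.

(** A layered form of |A + B| >= |A| + |B| - 1 for finite sets of integers. [half_merge] is applied
    on each side of the peaks [p] and [q]; the two peaks share the single index [p + q], whence the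
    subtracted [a p]. *)
Lemma rsum_merge (a b H : nat -> R) n1 n2 p q : (p < n1)%nat -> (q < n2)%nat -> a p = b q ->
  (forall i, (p <= i)%nat -> (S i < n1)%nat -> a (S i) <= a i) ->
  (forall i, (S i <= p)%nat -> a i <= a (S i)) ->
  (forall j, (q <= j)%nat -> (S j < n2)%nat -> b (S j) <= b j) ->
  (forall j, (S j <= q)%nat -> b j <= b (S j)) ->
  (forall i j, (i < n1)%nat -> (j < n2)%nat -> Rmin (a i) (b j) <= H (i + j)%nat) ->
  rsum n1 a + rsum n2 b - a p <= rsum (n1 + n2 - 1) H.
Proof.
  intros Hp Hq E A1 A2 B1 B2 HH.
  rewrite (rsum_split_at n1 p), (rsum_split_at n2 q),
    (rsum_split_at (n1 + n2 - 1) (p + q)) by lia.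
  assert (U := half_merge (fun i => a (p + i)%nat) (fun j => b (q + j)%nat)
    (fun k => H (p + q + k)%nat) ltac:(cbv beta; rewrite !Nat.add_0_r; exact E)
    _ (n1 - p - 1)%nat (n2 - q - 1)%nat (le_n _)
    ltac:(cbv beta; intros i Hi; rewrite Nat.add_succ_r; apply A1; lia)
    ltac:(cbv beta; intros i Hi; rewrite Nat.add_succ_r; apply B1; lia)
    ltac:(cbv beta; intros i j Hi Hj; replace (p + q + (i + j))%nat with (p + i + (q + j))%nat by lia;
          apply HH; lia)).
  assert (V := half_merge (fun i => a (p - i)%nat) (fun j => b (q - j)%nat)
    (fun k => H (p + q - k)%nat) ltac:(cbv beta; rewrite !Nat.sub_0_r; exact E)
    _ p q (le_n _)
    ltac:(cbv beta; intros i Hi; replace (p - i)%nat with (S (p - S i))%nat by lia; apply A2; lia)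
    ltac:(cbv beta; intros i Hi; replace (q - i)%nat with (S (q - S i))%nat by lia; apply B2; lia)
    ltac:(cbv beta; intros i j Hi Hj; replace (p + q - (i + j))%nat with (p - i + (q - j))%nat by lia;
          apply HH; lia)).
  cbv beta in U, V.
  assert (M : a p <= H (p + q)%nat).
  { specialize (HH p q Hp Hq); rewrite Rmin_left in HH by lra; exact HH. }
  replace (n1 + n2 - 1 - (p + q) - 1)%nat with (n1 - p - 1 + (n2 - q - 1))%nat by lia.
  rewrite (rsum_ext p _ (fun i => a (p - S i)%nat)) by (intros; f_equal; lia).
  rewrite (rsum_ext q _ (fun i => b (q - S i)%nat)) by (intros; f_equal; lia).
  rewrite (rsum_ext (p + q) _ (fun i => H (p + q - S i)%nat)) by (intros; f_equal; lia).
  rewrite (rsum_ext (n1 - p - 1) _ (fun i => a (p + S i)%nat)) by (intros; f_equal; lia).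
  rewrite (rsum_ext (n2 - q - 1) _ (fun i => b (q + S i)%nat)) by (intros; f_equal; lia).
  rewrite (rsum_ext (n1 - p - 1 + (n2 - q - 1)) _ (fun i => H (p + q + S i)%nat))
    by (intros; f_equal; lia).
  lra.
Qed.

(** * Dyadic Riemann sums on the line *)

Definition dyadic_sum (k : nat) (phi : R -> R) : R :=
  apsum (/ 2 ^ k) (- 2 ^ k) (S (2 * 4 ^ k)) phi.

Definition supp1 (rad : R) (phi : R -> R) : Prop := forall x, phi x <> 0 -> Rabs x <= rad.

(** There are [2 * 4 ^ k + 1] samples, so the half-open cells reach one step beyond [2 ^ k] and
    cover the closed interval, as the support condition of [apsum_compare] asks. *)
Lemma dyadic_range k : - 2 ^ k + / 2 ^ k * INR (S (2 * 4 ^ k)) = 2 ^ k + / 2 ^ k.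
Proof.
  rewrite S_INR, mult_INR, pow4_INR; simpl (INR 2); field.
  pose proof (pow2_pos k); lra.
Qed.

Lemma apsum_le_dyadic f rad B h al n k : qconc f -> (forall x, 0 <= f x <= B) ->
  supp1 rad f -> rad < 2 ^ k -> 0 < h ->
  apsum h al n f <= dyadic_sum k f + B * (h + / 2 ^ k).
Proof.
  intros Hq Hb Hs Hk Hh; apply apsum_compare; auto using inv_pow2_pos.
  intros x Hx; apply Hs, Rabs_bounds in Hx; rewrite dyadic_range.
  pose proof (inv_pow2_pos k); lra.
Qed.

Lemma dyadic_sum_bound f rad B k : qconc f -> (forall x, 0 <= f x <= B) ->
  supp1 rad f -> 0 <= rad -> dyadic_sum k f <= B * (4 * rad + 4).
Proof.
  intros Hq Hb Hs Hr.
  assert (HB : 0 <= B) by (pose proof (Hb 0); lra).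
  (* The comparison grid has one sample, whose cell of length [2 * rad + 1] contains the whole
     support. Hence the bound holds for every [k], even for coarse grids. *)
  apply Rle_trans with (apsum (2 * rad + 1) (- rad) 1 f + B * (/ 2 ^ k + (2 * rad + 1))).
  - apply apsum_compare; auto using inv_pow2_pos; [lra|].
    intros x Hx; apply Hs, Rabs_bounds in Hx; simpl; lra.
  - unfold apsum; simpl.
    pose proof (Hb (- rad + (2 * rad + 1) * 0)).
    assert (/ 2 ^ k <= 1).
    { rewrite <- Rinv_1; apply Rinv_le_contravar; [lra|apply pow_R1_Rle; lra]. }
    nra.
Qed.

Lemma dyadic_sum_rate f rad B k l : qconc f -> (forall x, 0 <= f x <= B) ->
  supp1 rad f -> rad < 2 ^ k -> rad < 2 ^ l ->
  Rabs (dyadic_sum k f - dyadic_sum l f) <= B * (/ 2 ^ k + / 2 ^ l).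
Proof.
  intros Hq Hb Hs Hk Hl; apply Rabs_le; split.
  - pose proof (apsum_le_dyadic f rad B (/ 2 ^ l) (- 2 ^ l) (S (2 * 4 ^ l)) k
      Hq Hb Hs Hk (inv_pow2_pos l)); fold (dyadic_sum l f) in *; lra.
  - pose proof (apsum_le_dyadic f rad B (/ 2 ^ k) (- 2 ^ k) (S (2 * 4 ^ k)) l
      Hq Hb Hs Hl (inv_pow2_pos k)); fold (dyadic_sum k f) in *; lra.
Qed.

Lemma dyadic_sum_cv f rad B : qconc f -> (forall x, 0 <= f x <= B) -> supp1 rad f ->
  exists I, Un_cv (fun k => dyadic_sum k f) I /\
    forall k, rad < 2 ^ k -> Rabs (dyadic_sum k f - I) <= B * / 2 ^ k.
Proof.
  intros Hq Hb Hs; destruct (pow2_large rad) as [K HK].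
  destruct (rate_Cauchy_cv (fun k => dyadic_sum k f) B K) as [I HI].
  { intros; apply (dyadic_sum_rate f rad); auto. }
  exists I; split; [exact HI|]; intros k Hk.
  apply (approx_limit (fun k => dyadic_sum k f) I B k); auto.
  intros k' l' Hk' Hl'; apply (dyadic_sum_rate f rad); auto;
    (eapply Rlt_le_trans; [exact Hk|]; apply Rle_pow; lra || lia).
Qed.

Lemma qconc_grid f h al n p : qconc f -> 0 < h ->
  (forall i, (i < n)%nat -> f (al + h * INR i) <= f (al + h * INR p)) -> (p < n)%nat ->
  (forall i, (p <= i)%nat -> (S i < n)%nat ->
     f (al + h * INR (S i)) <= f (al + h * INR i)) /\
  (forall i, (S i <= p)%nat -> f (al + h * INR i) <= f (al + h * INR (S i))).
Proof.
  intros Hq Hh Hm Hp; split; intros i Hi; [intros Hi'|].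
  - assert (Q := Hq (al + h * INR p) (al + h * INR i) (al + h * INR (S i))).
    rewrite Rmin_right in Q by (apply Hm; lia); apply Q.
    apply le_INR in Hi; rewrite S_INR; nra.
  - assert (Q := Hq (al + h * INR i) (al + h * INR (S i)) (al + h * INR p)).
    rewrite Rmin_left in Q by (apply Hm; lia); apply Q.
    apply le_INR in Hi; rewrite S_INR in Hi |- *; nra.
Qed.

Lemma argmax_pos h al n f : 0 < h -> (forall x, 0 <= f x) -> 0 < apsum h al n f ->
  exists p, (p < n)%nat /\ 0 < f (al + h * INR p) /\
    forall i, (i < n)%nat -> f (al + h * INR i) <= f (al + h * INR p).
Proof.
  intros Hh H0 Hpos; unfold apsum in Hpos.
  destruct n as [|n]; [simpl in Hpos; lra|].
  destruct (rsum_argmax (S n) (fun i => f (al + h * INR i)) ltac:(lia)) as [p [Hp Hm]].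
  exists p; split; [exact Hp|split; [|exact Hm]].
  destruct (H0 (al + h * INR p)) as [|E]; [assumption|exfalso].
  rewrite rsum_zero in Hpos; [lra|].
  intros i Hi; specialize (Hm i Hi); cbv beta in Hm; pose proof (H0 (al + h * INR i)); lra.
Qed.

(* With steps h/l and h/(1-l), the points l s_i + (1-l) t_j form a grid of step h. *)
Lemma prekopa_leindler_grid f g H B l h a1 a2 n :
  0 < l < 1 -> 0 < h -> qconc f -> qconc g ->
  (forall x, 0 <= f x <= B) -> (forall x, 0 <= g x <= B) -> (forall x, 0 <= H x) ->
  (forall s t, 0 < f s -> 0 < g t -> gmean l (f s) (g t) <= H (l * s + (1 - l) * t)) ->
  0 < apsum (h / l) a1 n f -> 0 < apsum (h / (1 - l)) a2 n g ->
  gmean l (apsum (h / l) a1 n f) (apsum (h / (1 - l)) a2 n g)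
  <= apsum h (l * a1 + (1 - l) * a2) (n + n - 1) H + B * h.
Proof.
  intros Hl Hh Qf Qg Bf Bg H0 HH Pf Pg.
  assert (h1 : 0 < h / l) by (apply Rdiv_lt_0_compat; lra).
  assert (h2 : 0 < h / (1 - l)) by (apply Rdiv_lt_0_compat; lra).
  destruct (argmax_pos _ _ _ _ h1 (fun x => proj1 (Bf x)) Pf) as [p [Hp [Fp Mp]]].
  destruct (argmax_pos _ _ _ _ h2 (fun x => proj1 (Bg x)) Pg) as [q [Hq [Gq Mq]]].
  destruct (qconc_grid _ _ _ _ _ Qf h1 Mp Hp) as [F1 F2].
  destruct (qconc_grid _ _ _ _ _ Qg h2 Mq Hq) as [G1 G2].
  set (A := f (a1 + h / l * INR p)) in *.
  set (C := g (a2 + h / (1 - l) * INR q)) in *.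
  assert (iA : 0 < / A) by (apply Rinv_0_lt_compat; assumption).
  assert (iC : 0 < / C) by (apply Rinv_0_lt_compat; assumption).
  set (c := gmean l A C).
  assert (c0 : 0 < c) by apply gmean_pos.
  assert (cB : c <= B).
  { unfold c; pose proof (Bf (a1 + h / l * INR p)) as B1.
    pose proof (Bg (a2 + h / (1 - l) * INR q)) as B2; fold A in B1; fold C in B2.
    rewrite <- (gmean_diag l B) by lra; apply gmean_mono; lra. }
  (* Dividing by the grid maxima [A] and [C] gives both sequences the peak value 1, as [rsum_merge]
     requires. [H] is divided by [c], the geometric mean of [A] and [C], which preserves the
     hypothesis because [gmean] is multiplicative. *)
  assert (M := rsum_merge (fun i => / A * f (a1 + h / l * INR i))
    (fun j => / C * g (a2 + h / (1 - l) * INR j))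
    (fun k => / c * H (l * a1 + (1 - l) * a2 + h * INR k)) n n p q Hp Hq
    ltac:(cbv beta; fold A; fold C; rewrite !Rinv_l by lra; reflexivity)
    ltac:(intros; apply Rmult_le_compat_l; [lra|auto])
    ltac:(intros; apply Rmult_le_compat_l; [lra|auto])
    ltac:(intros; apply Rmult_le_compat_l; [lra|auto])
    ltac:(intros; apply Rmult_le_compat_l; [lra|auto])).
  cbv beta in M; rewrite !rsum_scal in M.
  assert (M' : / A * rsum n (fun i => f (a1 + h / l * INR i)) +
    / C * rsum n (fun j => g (a2 + h / (1 - l) * INR j)) - / A * f (a1 + h / l * INR p)
    <= / c * rsum (n + n - 1) (fun k => H (l * a1 + (1 - l) * a2 + h * INR k))).
  { apply M; intros i j Hi Hj.
    assert (ic : 0 < / c) by (apply Rinv_0_lt_compat; assumption).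
    assert (P : 0 <= / c * H (l * a1 + (1 - l) * a2 + h * INR (i + j))).
    { apply Rmult_le_pos; [lra|apply H0]. }
    set (s := a1 + h / l * INR i); set (t := a2 + h / (1 - l) * INR j).
    destruct (proj1 (Bf s)) as [fs|E].
    2:{ rewrite <- E, Rmult_0_r; eapply Rle_trans; [apply Rmin_l|exact P]. }
    destruct (proj1 (Bg t)) as [gt|E].
    2:{ rewrite <- E, Rmult_0_r; eapply Rle_trans; [apply Rmin_r|exact P]. }
    replace (l * a1 + (1 - l) * a2 + h * INR (i + j)) with (l * s + (1 - l) * t).
    2:{ unfold s, t; rewrite plus_INR; field; lra. }
    eapply Rle_trans; [apply (gmean_min l); [exact Hl|apply Rmult_lt_0_compat; assumption..]|].
    rewrite gmean_mult by assumption.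
    apply Rle_trans with (gmean l (/ A) (/ C) * H (l * s + (1 - l) * t)).
    - apply Rmult_le_compat_l; [left; apply gmean_pos|apply HH; assumption].
    - right; f_equal.
      apply Rmult_eq_reg_l with c; [|lra].
      rewrite Rinv_r by lra; unfold c; rewrite <- gmean_mult by assumption.
      rewrite !Rinv_r by lra; apply gmean_diag; lra. }
  fold A in M'; rewrite Rinv_l in M' by lra.
  unfold apsum in *.
  set (Sf := rsum n (fun i => f _)) in *; set (Sg := rsum n (fun i => g _)) in *.
  set (SH := rsum (n + n - 1) _) in *.
  set (u := h / l * Sf) in *; set (v := h / (1 - l) * Sg) in *.
  replace u with (A * (/ A * u)) by (field; lra).
  replace v with (C * (/ C * v)) by (field; lra).
  rewrite gmean_mult by (assumption || apply Rmult_lt_0_compat; assumption).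
  fold c.
  (* After normalisation AM-GM suffices: the steps [h / l] and [h / (1 - l)] make the weighted
     arithmetic mean of the two sums exactly [h] times the left side of the merged inequality. The
     peak counted twice there leaves [c * h]. *)
  apply Rle_trans with (c * (l * (/ A * u) + (1 - l) * (/ C * v))).
  { apply Rmult_le_compat_l; [lra|]; apply gmean_amgm; [exact Hl|apply Rmult_lt_0_compat; assumption..]. }
  replace (l * (/ A * u) + (1 - l) * (/ C * v)) with (h * (/ A * Sf + / C * Sg)).
  2:{ unfold u, v; field; lra. }
  apply Rle_trans with (c * (h * (/ c * SH + 1))).
  { apply Rmult_le_compat_l; [lra|]; apply Rmult_le_compat_l; lra. }
  replace (c * (h * (/ c * SH + 1))) with (h * SH + c * h) by (field; lra); nra.
Qed.

(** Limit of the grid inequality. The sums on the stretched grids are bounded below by [(1 - d)]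
    times the integrals; such a factor passes through [gmean] by homogeneity, so no continuity of
    [gmean] is invoked. *)
Lemma prekopa_leindler_1 f g H rad B l If Ig IH :
  0 < l < 1 -> qconc f -> qconc g -> qconc H ->
  (forall x, 0 <= f x <= B) -> (forall x, 0 <= g x <= B) -> (forall x, 0 <= H x <= B) ->
  supp1 rad f -> supp1 rad g -> supp1 rad H ->
  (forall s t, 0 < f s -> 0 < g t -> gmean l (f s) (g t) <= H (l * s + (1 - l) * t)) ->
  Un_cv (fun k => dyadic_sum k f) If -> Un_cv (fun k => dyadic_sum k g) Ig ->
  Un_cv (fun k => dyadic_sum k H) IH -> 0 < If -> 0 < Ig -> gmean l If Ig <= IH.
Proof.
  intros Hl Qf Qg QH Bf Bg BH Sf Sg SH HH Cf Cg CH Pf Pg.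
  assert (HB : 0 <= B) by (pose proof (Bf 0); lra).
  destruct (pow2_large rad) as [K HK].
  (* [m] stands for [l] or [1 - l]. Origin and step are both divided by [m <= 1], so the stretched
     grid still covers the support. *)
  assert (L : forall phi I m, 0 < m <= 1 -> qconc phi -> (forall x, 0 <= phi x <= B) ->
    supp1 rad phi -> Un_cv (fun k => dyadic_sum k phi) I -> 0 < I ->
    forall d, 0 < d -> exists K', forall k, (K' <= k)%nat ->
      (1 - d) * I <= apsum (/ 2 ^ k / m) (- 2 ^ k / m) (S (2 * 4 ^ k)) phi).
  { intros phi I m Hm Qp Bp Sp Cp Ip d Hd.
    assert (Cp' := CV_minus _ _ _ _ Cp (inv_pow2_cv (B * (1 + / m)))).
    destruct (Cp' (d * I) ltac:(nra)) as [N HN]; exists (N + K)%nat; intros k Hk.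
    specialize (HN k ltac:(lia)); unfold Rdist in HN; apply Rabs_def2 in HN.
    assert (im : 0 < / m) by (apply Rinv_0_lt_compat; lra).
    assert (im1 : 1 <= / m) by (rewrite <- Rinv_1; apply Rinv_le_contravar; lra).
    pose proof (inv_pow2_pos k) as ik; pose proof (pow2_pos k) as pk.
    assert (C := apsum_compare phi B (/ 2 ^ k) (/ 2 ^ k / m) (- 2 ^ k) (- 2 ^ k / m)
      (S (2 * 4 ^ k)) (S (2 * 4 ^ k)) Qp Bp ik
      ltac:(unfold Rdiv; apply Rmult_lt_0_compat; lra)).
    fold (dyadic_sum k phi) in C.
    assert (C' : dyadic_sum k phi <= apsum (/ 2 ^ k / m) (- 2 ^ k / m) (S (2 * 4 ^ k)) phi
      + B * (/ 2 ^ k + / 2 ^ k / m)).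
    { apply C; intros x Hx; apply Sp, Rabs_bounds in Hx; specialize (HK k ltac:(lia)).
      replace (- 2 ^ k / m + / 2 ^ k / m * INR (S (2 * 4 ^ k)))
        with ((- 2 ^ k + / 2 ^ k * INR (S (2 * 4 ^ k))) * / m) by (field; lra).
      rewrite dyadic_range; unfold Rdiv; nra. }
    unfold Rdiv in *; nra. }
  assert (D : forall d, 0 < d < 1 -> (1 - d) * gmean l If Ig <= IH).
  { intros d Hd.
    destruct (L f If l ltac:(lra) Qf Bf Sf Cf Pf d ltac:(lra)) as [K1 L1].
    destruct (L g Ig (1 - l) ltac:(lra) Qg Bg Sg Cg Pg d ltac:(lra)) as [K2 L2].
    assert (CH' := CV_plus _ _ _ _ CH (inv_pow2_cv (3 * B))).
    rewrite Rplus_0_r in CH'.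
    apply (Un_cv_le (fun _ => (1 - d) * gmean l If Ig) _ _ _ (K + K1 + K2)
      ) with (2 := Un_cv_const _) (3 := CH').
    intros k Hk; specialize (L1 k ltac:(lia)); specialize (L2 k ltac:(lia)).
    pose proof (inv_pow2_pos k) as ik.
    assert (0 < (1 - d) * If) by (apply Rmult_lt_0_compat; lra).
    assert (0 < (1 - d) * Ig) by (apply Rmult_lt_0_compat; lra).
    assert (P := prekopa_leindler_grid f g H B l (/ 2 ^ k) (- 2 ^ k / l) (- 2 ^ k / (1 - l))
      (S (2 * 4 ^ k)) Hl ik Qf Qg Bf Bg (fun x => proj1 (BH x)) HH ltac:(lra) ltac:(lra)).
    assert (Q := apsum_le_dyadic H rad B (/ 2 ^ k)
      (l * (- 2 ^ k / l) + (1 - l) * (- 2 ^ k / (1 - l)))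
      (S (2 * 4 ^ k) + S (2 * 4 ^ k) - 1) k QH BH SH (HK k ltac:(lia)) ik).
    apply Rle_trans with (gmean l ((1 - d) * If) ((1 - d) * Ig)).
    - rewrite gmean_mult, gmean_diag by lra; lra.
    - eapply Rle_trans; [apply gmean_mono; [exact Hl|split; [|exact L1]; lra|
        split; [|exact L2]; lra]|].
      cbv beta; lra. }
  destruct (Rle_dec (gmean l If Ig) IH) as [|Hn]; [assumption|exfalso].
  pose proof (gmean_pos l If Ig) as gp.
  set (x := gmean l If Ig) in *.
  destruct (Rle_dec IH 0) as [Hneg|Hp].
  - specialize (D (/ 2) ltac:(lra)); lra.
  - specialize (D ((x - IH) / (2 * x))).
    assert (E : (1 - (x - IH) / (2 * x)) * x = (x + IH) / 2) by (field; lra).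
    rewrite E in D.
    assert ((x + IH) / 2 <= IH); [apply D; split|lra].
    + apply Rdiv_lt_0_compat; lra.
    + apply Rmult_lt_reg_r with (2 * x); [lra|].
      unfold Rdiv; rewrite Rmult_assoc, Rinv_l by lra; lra.
Qed.

(** * Grid sums in dimension n *)

Lemma apsum_le h al n f g : 0 < h -> (forall x, f x <= g x) ->
  apsum h al n f <= apsum h al n g.
Proof. intros Hh H; apply Rmult_le_compat_l; [lra|]; apply rsum_le; auto. Qed.

Lemma apsum_plus h al n f g :
  apsum h al n (fun x => f x + g x) = apsum h al n f + apsum h al n g.
Proof. unfold apsum; rewrite rsum_plus; ring. Qed.

Lemma apsum_scal h al n c f : apsum h al n (fun x => c * f x) = c * apsum h al n f.
Proof. unfold apsum; rewrite rsum_scal; ring. Qed.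

Lemma dyadic_sum_opp k f : dyadic_sum k (fun x => f (- x)) = dyadic_sum k f.
Proof.
  unfold dyadic_sum, apsum; f_equal; rewrite rsum_rev; apply rsum_ext.
  intros i Hi; f_equal.
  replace (S (2 * 4 ^ k) - 1 - i)%nat with (2 * 4 ^ k - i)%nat by lia.
  rewrite minus_INR, mult_INR, pow4_INR by lia; simpl (INR 2).
  field; pose proof (pow2_pos k); lra.
Qed.

(** [grid_sum] with the factor [h ^ d] distributed one [h] per coordinate: nested one-dimensional
    sums, the last coordinate outermost, as the induction on the dimension requires. *)
Fixpoint gsum (n k : nat) (f : vec -> R) : R :=
  match n with
  | O => f zero_vec
  | S m => dyadic_sum k (fun s => gsum m k (fun x => f (upd x m s)))
  end.

Lemma sum_f_R0_rsum n f : sum_f_R0 f n = rsum (S n) f.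
Proof. induction n as [|n IH]; simpl in *; [ring|rewrite IH; reflexivity]. Qed.

Lemma upd_scal c x n s :
  (fun i => c * upd x n s i) = upd (fun i => c * x i) n (c * s).
Proof. extensionality i; unfold upd; destruct (Nat.eqb i n); reflexivity. Qed.

Lemma grid_sum_gsum n k f : grid_sum n k f = gsum n k f.
Proof.
  unfold grid_sum; revert f; induction n as [|n IH]; intros f; simpl.
  - rewrite Rmult_1_l; f_equal; extensionality i; unfold zero_vec; ring.
  - rewrite sum_f_R0_rsum, Rmult_assoc, <- rsum_scal.
    unfold dyadic_sum, apsum; f_equal; apply rsum_ext; intros t _.
    rewrite <- IH; f_equal; f_equal; extensionality x; f_equal.
    rewrite upd_scal; f_equal.
    rewrite pow4_INR; field; pose proof (pow2_pos k); lra.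
Qed.

Lemma gsum_le n k f g : (forall x, f x <= g x) -> gsum n k f <= gsum n k g.
Proof.
  revert f g; induction n as [|n IH]; intros f g H; simpl; [apply H|].
  apply apsum_le; [apply inv_pow2_pos|]; intros s; apply IH; auto.
Qed.

Lemma gsum_plus n k f g : gsum n k (fun x => f x + g x) = gsum n k f + gsum n k g.
Proof.
  revert f g; induction n as [|n IH]; intros f g; simpl; [reflexivity|].
  unfold dyadic_sum; rewrite <- apsum_plus; f_equal; extensionality s; apply IH.
Qed.

Lemma gsum_scal n k c f : gsum n k (fun x => c * f x) = c * gsum n k f.
Proof.
  revert f; induction n as [|n IH]; intros f; simpl; [reflexivity|].
  unfold dyadic_sum; rewrite <- apsum_scal; f_equal; extensionality s; apply IH.
Qed.

Lemma gsum_ext n k f g : (forall x, f x = g x) -> gsum n k f = gsum n k g.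
Proof. intros H; f_equal; extensionality x; apply H. Qed.

Lemma gsum_zero n k : gsum n k (fun _ => 0) = 0.
Proof.
  rewrite (gsum_ext n k _ (fun x => 0 * 0)) by (intros; ring).
  rewrite gsum_scal; ring.
Qed.

Lemma gsum_nonneg n k f : (forall x, 0 <= f x) -> 0 <= gsum n k f.
Proof. intros H; rewrite <- (gsum_zero n k); apply gsum_le, H. Qed.

Lemma gsum_rsum n k m (f : nat -> vec -> R) :
  gsum n k (fun x => rsum m (fun i => f i x)) = rsum m (fun i => gsum n k (f i)).
Proof.
  induction m as [|m IH]; simpl; [apply gsum_zero|].
  rewrite gsum_plus, IH; reflexivity.
Qed.

Lemma gsum_opp n k f : gsum n k (fun x => f (fun i => - x i)) = gsum n k f.
Proof.
  revert f; induction n as [|n IH]; intros f; simpl.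
  - f_equal; extensionality i; unfold zero_vec; ring.
  - rewrite <- dyadic_sum_opp; f_equal; extensionality s.
    rewrite <- IH; apply gsum_ext; intros x; f_equal; extensionality i.
    unfold upd; destruct (Nat.eqb i n); ring.
Qed.

Definition gint (n : nat) (f : vec -> R) : R :=
  epsilon (inhabits 0) (fun I => Un_cv (fun k => gsum n k f) I).

Lemma gint_eq n f I : Un_cv (fun k => gsum n k f) I -> gint n f = I.
Proof.
  intros H; apply (UL_sequence (fun k => gsum n k f)); [|exact H].
  unfold gint; apply epsilon_spec; exists I; exact H.
Qed.

(** * Log-concave functions and their marginals *)

Definition comb (l : R) (x y : vec) : vec := fun i => l * x i + (1 - l) * y i.

Lemma comb_upd l x y n s t :
  comb l (upd x n s) (upd y n t) = upd (comb l x y) n (l * s + (1 - l) * t).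
Proof. extensionality i; unfold comb, upd; destruct (Nat.eqb i n); reflexivity. Qed.

(** [rad] and [B] are parameters so that all slices of one function share them; the rates of
    convergence are then uniform over the slices. *)
Record log_concave (n : nat) (rad B : R) (f : vec -> R) : Prop := {
  lc_bound : forall x, 0 <= f x <= B;
  lc_comb : forall l x y, 0 < l < 1 -> 0 < f x -> 0 < f y ->
    gmean l (f x) (f y) <= f (comb l x y);
  lc_supp : forall x i, (i < n)%nat -> f x <> 0 -> Rabs (x i) <= rad }.

Lemma lc_slice n rad B f s : log_concave (S n) rad B f ->
  log_concave n rad B (fun x => f (upd x n s)).
Proof.
  intros [Hb Hc Hs]; split.
  - intros; apply Hb.
  - intros l x y Hl Hx Hy; specialize (Hc l _ _ Hl Hx Hy); rewrite comb_upd in Hc.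
    replace (l * s + (1 - l) * s) with s in Hc by ring; exact Hc.
  - intros x i Hi Hx; specialize (Hs _ i ltac:(lia) Hx); unfold upd in Hs.
    destruct (Nat.eqb_spec i n); [lia|exact Hs].
Qed.

Lemma qconc_of_gmean phi : (forall x, 0 <= phi x) ->
  (forall l s t, 0 < l < 1 -> 0 < phi s -> 0 < phi t ->
     gmean l (phi s) (phi t) <= phi (l * s + (1 - l) * t)) -> qconc phi.
Proof.
  intros H0 H x y z [Hxy Hyz].
  destruct Hxy as [Hxy|<-]; [|apply Rmin_l].
  destruct Hyz as [Hyz| ->]; [|apply Rmin_r].
  destruct (H0 x) as [Px|E].
  2:{ rewrite <- E; eapply Rle_trans; [apply Rmin_l|apply H0]. }
  destruct (H0 z) as [Pz|E].
  2:{ rewrite <- E; eapply Rle_trans; [apply Rmin_r|apply H0]. }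
  set (l := (z - y) / (z - x)).
  assert (Hl : 0 < l < 1).
  { unfold l; split; [apply Rdiv_lt_0_compat; lra|].
    apply Rmult_lt_reg_r with (z - x); [lra|].
    unfold Rdiv; rewrite Rmult_assoc, Rinv_l by lra; lra. }
  replace y with (l * x + (1 - l) * z) by (unfold l; field; lra).
  eapply Rle_trans; [apply (gmean_min l); assumption|]; apply H; assumption.
Qed.

Lemma rate_cv u a c K : (forall k, (K <= k)%nat -> Rabs (u k - a) <= c * / 2 ^ k) ->
  Un_cv u a.
Proof.
  intros H e He; destruct (inv_pow2_cv c e He) as [N HN]; exists (N + K)%nat.
  intros k Hk; specialize (HN k ltac:(lia)); unfold Rdist in *.
  rewrite Rminus_0_r in HN; apply Rabs_def2 in HN; specialize (H k ltac:(lia)); lra.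
Qed.

(** The difference is dominated by [c] times the indicator of [[-rad, rad]]. That majorant is
    quasi-concave, so [dyadic_sum_bound] applies to it although it need not apply to the
    difference. *)
Lemma dyadic_sum_dist k f g c rad : 0 <= c -> 0 <= rad ->
  supp1 rad f -> supp1 rad g -> (forall x, Rabs (f x - g x) <= c) ->
  Rabs (dyadic_sum k f - dyadic_sum k g) <= c * (4 * rad + 4).
Proof.
  intros Hc Hr Sf Sg H.
  set (chi := fun s => if Rle_dec (Rabs s) rad then c else 0).
  assert (D : dyadic_sum k chi <= c * (4 * rad + 4)).
  { apply dyadic_sum_bound; [|intros x; unfold chi; destruct Rle_dec; lra| |exact Hr].
    - intros x y z Hxyz; unfold chi.
      destruct (Rle_dec (Rabs y) rad) as [|Hy].
      + eapply Rle_trans; [apply Rmin_l|]; destruct Rle_dec; lra.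
      + destruct (Rle_dec (Rabs x) rad) as [Hx|]; [|destruct (Rle_dec (Rabs z) rad); rewrite Rmin_left; lra].
        destruct (Rle_dec (Rabs z) rad) as [Hz|]; [|rewrite Rmin_right; lra].
        apply Rabs_bounds in Hx; apply Rabs_bounds in Hz.
        exfalso; apply Hy, Rabs_le; lra.
    - intros x Hx; unfold chi in Hx; destruct Rle_dec; [assumption|lra]. }
  assert (E : forall x, Rabs (f x - g x) <= chi x).
  { intros x; unfold chi; destruct Rle_dec as [|Hx]; [apply H|].
    destruct (Req_dec (f x) 0) as [->|Hf]; [|exfalso; auto].
    destruct (Req_dec (g x) 0) as [->|Hg]; [|exfalso; auto].
    rewrite Rminus_0_r, Rabs_R0; lra. }
  pose proof (inv_pow2_pos k) as ik.
  assert (dyadic_sum k f <= dyadic_sum k g + dyadic_sum k chi).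
  { unfold dyadic_sum; rewrite <- apsum_plus; apply apsum_le; [exact ik|].
    intros x; specialize (E x); apply Rabs_bounds in E; lra. }
  assert (dyadic_sum k g <= dyadic_sum k f + dyadic_sum k chi).
  { unfold dyadic_sum; rewrite <- apsum_plus; apply apsum_le; [exact ik|].
    intros x; specialize (E x); apply Rabs_bounds in E; lra. }
  apply Rabs_le; lra.
Qed.

(* Convergence in dimension n+1 needs the marginal in the last variable to be
   quasi-concave, which is Prekopa-Leindler in dimension n: hence a joint induction. *)
Lemma gsum_cv_and_prekopa_leindler n rad : 0 <= rad ->
  (forall B, 0 <= B -> exists C, 0 <= C /\ forall f, log_concave n rad B f ->
     0 <= gint n f <= C /\
     forall k, rad < 2 ^ k -> Rabs (gsum n k f - gint n f) <= C * / 2 ^ k) /\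
  (forall B f g H l, 0 < l < 1 ->
     log_concave n rad B f -> log_concave n rad B g -> log_concave n rad B H ->
     (forall x y, 0 < f x -> 0 < g y -> gmean l (f x) (g y) <= H (comb l x y)) ->
     0 < gint n f -> 0 < gint n g -> gmean l (gint n f) (gint n g) <= gint n H).
Proof.
  intros Hr; induction n as [|n [IHc IHp]].
  - assert (E : forall f, gint 0 f = f zero_vec).
    { intros f; apply gint_eq; simpl; apply Un_cv_const. }
    split.
    + intros B HB; exists B; split; [exact HB|]; intros f Hf; rewrite E; split.
      * apply Hf.
      * intros k _; simpl; unfold Rminus; rewrite Rplus_opp_r, Rabs_R0.
        pose proof (inv_pow2_pos k); nra.
    + intros B f g H l Hl _ _ _ HH; rewrite !E; intros Pf Pg.
      specialize (HH _ _ Pf Pg); replace (comb l zero_vec zero_vec) with zero_vec in HH;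
        [exact HH|]; extensionality i; unfold comb, zero_vec; ring.
  - set (marg := fun f s => gint n (fun x => f (upd x n s))).
    (* One [C] serves all slices, and slices beyond [rad] vanish. Replacing the inner sums by their
       limits therefore costs [C * / 2 ^ k] uniformly in [s], and the factor [4 * rad + 4] after
       summation over [s]. *)
    assert (F : forall B, 0 <= B -> exists C, 0 <= C /\ forall f, log_concave (S n) rad B f ->
      qconc (marg f) /\ (forall s, 0 <= marg f s <= C) /\ supp1 rad (marg f) /\
      forall k, rad < 2 ^ k ->
        Rabs (gsum (S n) k f - dyadic_sum k (marg f)) <= C * (4 * rad + 4) * / 2 ^ k).
    { intros B HB; destruct (IHc B HB) as [C [HC HI]]; exists C; split; [exact HC|].
      intros f Hf.
      assert (Z : forall s, rad < Rabs s -> (fun x => f (upd x n s)) = fun _ => 0).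
      { intros s Hs; extensionality x.
        destruct (Req_dec (f (upd x n s)) 0) as [|Hne]; [assumption|exfalso].
        apply (lc_supp _ _ _ _ Hf _ n ltac:(lia)) in Hne.
        unfold upd in Hne; rewrite Nat.eqb_refl in Hne; lra. }
      assert (S1 : supp1 rad (marg f)).
      { intros s Hs; apply Rnot_lt_le; intros Hs'; apply Hs; unfold marg; rewrite (Z s Hs').
        apply gint_eq, Un_cv_ext with (fun _ => 0); [|apply Un_cv_const].
        intros; rewrite gsum_zero; reflexivity. }
      assert (S2 : forall s, 0 <= marg f s <= C) by (intros s; apply HI, lc_slice, Hf).
      repeat split; auto; try apply S2.
      - apply qconc_of_gmean; [apply S2|]; intros l s t Hl Ps Pt.
        apply (IHp B); auto using lc_slice.
        intros x y Px Py; rewrite <- comb_upd; apply (lc_comb _ _ _ _ Hf); assumption.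
      - intros k Hk; simpl.
        replace (C * (4 * rad + 4) * / 2 ^ k) with (C * / 2 ^ k * (4 * rad + 4)) by ring.
        apply dyadic_sum_dist; auto.
        + pose proof (inv_pow2_pos k); nra.
        + intros s Hs; apply Rnot_lt_le; intros Hs'; apply Hs.
          rewrite (Z s Hs'); apply gsum_zero.
        + intros s; apply HI; [apply lc_slice, Hf|exact Hk]. }
    (* Fubini in the last variable: the sums of the marginal converge by quasi-concavity, and the
       full sums differ from them by O(2^-k). *)
    assert (M : forall B, 0 <= B -> forall f, log_concave (S n) rad B f ->
      Un_cv (fun k => dyadic_sum k (marg f)) (gint (S n) f)).
    { intros B HB f Hf; destruct (F B HB) as [C [HC HF]].
      destruct (HF f Hf) as [Qf [Bf [Sf Rf]]].
      destruct (dyadic_sum_cv _ _ _ Qf Bf Sf) as [I [HI _]].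
      replace (gint (S n) f) with I; [exact HI|].
      symmetry; apply gint_eq.
      destruct (pow2_large rad) as [K HK].
      assert (D : Un_cv (fun k => gsum (S n) k f - dyadic_sum k (marg f)) 0).
      { apply rate_cv with (C * (4 * rad + 4)) K; intros k Hk.
        rewrite Rminus_0_r; apply Rf, HK, Hk. }
      assert (D' := CV_plus _ _ _ _ D HI); rewrite Rplus_0_l in D'.
      apply Un_cv_ext with (2 := D'); intros k; ring. }
    split.
    + intros B HB; destruct (F B HB) as [C [HC HF]].
      exists (C * (4 * rad + 4) + C); split; [nra|]; intros f Hf.
      destruct (HF f Hf) as [Qf [Bf [Sf Rf]]].
      assert (Mf := M B HB f Hf).
      destruct (dyadic_sum_cv _ _ _ Qf Bf Sf) as [I [HI Rt]].
      rewrite (UL_sequence _ _ _ Mf HI) in *.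
      split; [split|].
      * apply (Un_cv_le (fun _ => 0) _ _ _ 0) with (2 := Un_cv_const 0) (3 := HI).
        intros k _; apply Rmult_le_pos; [left; apply inv_pow2_pos|].
        apply rsum_nonneg; intros; apply Bf.
      * apply Rle_trans with (C * (4 * rad + 4)); [|lra].
        apply (Un_cv_le _ (fun _ => C * (4 * rad + 4)) _ _ 0) with (2 := HI) (3 := Un_cv_const _).
        intros k _; apply (dyadic_sum_bound _ rad); auto.
      * intros k Hk; specialize (Rf k Hk); specialize (Rt k Hk).
        replace (gsum (S n) k f - I) with
          ((gsum (S n) k f - dyadic_sum k (marg f)) + (dyadic_sum k (marg f) - I)) by ring.
        eapply Rle_trans; [apply Rabs_triang|]; lra.
    + intros B f g H l Hl Hf Hg HH Hc Pf Pg.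
      assert (HB : 0 <= B) by (pose proof (lc_bound _ _ _ _ Hf zero_vec); lra).
      destruct (F B HB) as [C [HC HF]].
      destruct (HF f Hf) as [Qf [Bf [Sf _]]]; destruct (HF g Hg) as [Qg [Bg [Sg _]]].
      destruct (HF H HH) as [QH [BH [SH _]]].
      (* The hypothesis on the line is the inequality in dimension [n] for the slices at heights [s]
         and [t], whose combinations land in the slice at [l * s + (1 - l) * t]. *)
      apply (prekopa_leindler_1 (marg f) (marg g) (marg H) rad C l); auto; try (apply (M B); auto).
      intros s t Ps Pt; apply (IHp B); auto using lc_slice.
      intros x y Px Py; rewrite <- comb_upd; apply Hc; assumption.
Qed.

Lemma gint_cv n rad B f : 0 <= rad -> log_concave n rad B f ->
  Un_cv (fun k => gsum n k f) (gint n f).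
Proof.
  intros Hr Hf.
  assert (HB : 0 <= B) by (pose proof (lc_bound _ _ _ _ Hf zero_vec); lra).
  destruct (proj1 (gsum_cv_and_prekopa_leindler n rad Hr) B HB) as [C [HC HI]].
  destruct (pow2_large rad) as [K HK]; apply rate_cv with C K.
  intros k Hk; apply HI; auto.
Qed.

(** * Volumes of slabs *)

Lemma ind_in (A : vec -> Prop) x : A x -> ind A x = 1.
Proof. intros H; unfold ind; destruct excluded_middle_informative; tauto. Qed.

Lemma ind_out (A : vec -> Prop) x : ~ A x -> ind A x = 0.
Proof. intros H; unfold ind; destruct excluded_middle_informative; tauto. Qed.

Lemma ind_bounds A x : 0 <= ind A x <= 1.
Proof. unfold ind; destruct excluded_middle_informative; lra. Qed.

Lemma ind_le (A B : vec -> Prop) x : (A x -> B x) -> ind A x <= ind B x.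
Proof.
  intros H; destruct (excluded_middle_informative (A x)) as [a|a].
  - rewrite !ind_in by auto; lra.
  - rewrite ind_out by exact a; apply ind_bounds.
Qed.

Record convex_bounded (n : nat) (rad : R) (A : vec -> Prop) : Prop := {
  cb_rad : 0 <= rad;
  cb_bound : forall x i, (i < n)%nat -> A x -> Rabs (x i) <= rad;
  cb_comb : forall l x y, 0 < l < 1 -> A x -> A y -> A (comb l x y) }.

Lemma ind_log_concave n rad A : convex_bounded n rad A -> log_concave n rad 1 (ind A).
Proof.
  intros [_ Hb Hc]; split; [apply ind_bounds| |].
  - intros l x y Hl Hx Hy; unfold ind in *.
    repeat destruct excluded_middle_informative; try lra.
    + rewrite gmean_diag; lra.
    + exfalso; auto.
  - intros x i Hi Hx; apply Hb; [exact Hi|].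
    unfold ind in Hx; destruct excluded_middle_informative; [assumption|lra].
Qed.

Definition vol (n : nat) (A : vec -> Prop) : R := gint n (ind A).

Lemma vol_cv n rad A : convex_bounded n rad A ->
  Un_cv (fun k => gsum n k (ind A)) (vol n A).
Proof.
  intros H; apply (gint_cv n rad 1); [exact (cb_rad _ _ _ H)|apply ind_log_concave, H].
Qed.

Lemma vol_nonneg n rad A : convex_bounded n rad A -> 0 <= vol n A.
Proof.
  intros H; apply (Un_cv_le _ _ _ _ 0) with (2 := Un_cv_const 0) (3 := vol_cv n rad A H).
  intros; apply gsum_nonneg; intros; apply ind_bounds.
Qed.

Lemma vol_le n rad A B : convex_bounded n rad A -> convex_bounded n rad B ->
  (forall x, A x -> B x) -> vol n A <= vol n B.
Proof.
  intros HA HB H.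
  apply (Un_cv_le _ _ _ _ 0) with (2 := vol_cv n rad A HA) (3 := vol_cv n rad B HB).
  intros; apply gsum_le; intros; apply ind_le, H.
Qed.

Lemma brunn_minkowski n rad A B C l : 0 < l < 1 -> convex_bounded n rad A ->
  convex_bounded n rad B -> convex_bounded n rad C ->
  (forall x y, A x -> B y -> C (comb l x y)) ->
  0 < vol n A -> 0 < vol n B -> gmean l (vol n A) (vol n B) <= vol n C.
Proof.
  intros Hl HA HB HC H.
  apply (proj2 (gsum_cv_and_prekopa_leindler n rad (cb_rad _ _ _ HA)) 1);
    auto using ind_log_concave.
  intros x y; unfold ind; repeat destruct excluded_middle_informative; try lra.
  - rewrite gmean_diag; lra.
  - exfalso; auto.
Qed.

Lemma dot_comb n l x y xi :
  dot n (comb l x y) xi = l * dot n x xi + (1 - l) * dot n y xi.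
Proof.
  unfold dot; rewrite <- !rsum_scal, <- rsum_plus; apply rsum_ext.
  intros; unfold comb; ring.
Qed.

Lemma dot_opp n x xi : dot n (fun i => - x i) xi = - dot n x xi.
Proof.
  unfold dot; replace (- rsum n (fun i => x i * xi i))
    with (-1 * rsum n (fun i => x i * xi i)) by ring.
  rewrite <- rsum_scal; apply rsum_ext; intros; ring.
Qed.

Lemma opp_mem (G : vec -> Prop) x : (forall y, G y -> G (fun i => - y i)) ->
  (G (fun i => - x i) <-> G x).
Proof.
  intros Hs; split; [|apply Hs]; intros H; apply Hs in H.
  replace x with (fun i => - - x i); [exact H|extensionality i; ring].
Qed.

Record symmetric_body (n : nat) (rad : R) (G : vec -> Prop) : Prop := {
  sb_cb : convex_bounded n rad G;
  sb_opp : forall x, G x -> G (fun i => - x i);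
  sb_vol : Un_cv (fun k => gsum n k (ind G)) 1 }.

Lemma dot_bounded n rad G xi : convex_bounded n rad G ->
  exists S, 0 < S /\ forall x, G x -> Rabs (dot n x xi) <= S.
Proof.
  intros H; exists (rsum n (fun i => rad * Rabs (xi i)) + 1); split.
  - pose proof (cb_rad _ _ _ H).
    assert (0 <= rsum n (fun i => rad * Rabs (xi i))); [|lra].
    apply rsum_nonneg; intros; apply Rmult_le_pos; [assumption|apply Rabs_pos].
  - intros x Hx; eapply Rle_trans; [apply rsum_abs|].
    assert (rsum n (fun i => Rabs (x i * xi i)) <= rsum n (fun i => rad * Rabs (xi i))); [|lra].
    apply rsum_le; intros i Hi; rewrite Rabs_mult.
    apply Rmult_le_compat_r; [apply Rabs_pos|apply (cb_bound _ _ _ H); assumption].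
Qed.

Definition slab (n : nat) (G : vec -> Prop) (xi : vec) (P : R -> Prop) : vec -> Prop :=
  fun x => G x /\ P (dot n x xi).

Definition interval (P : R -> Prop) : Prop :=
  forall l s t, 0 < l < 1 -> P s -> P t -> P (l * s + (1 - l) * t).

Lemma slab_cb n rad G xi P : convex_bounded n rad G -> interval P ->
  convex_bounded n rad (slab n G xi P).
Proof.
  intros [Hr Hb Hc] HP; split; [exact Hr| |].
  - intros x i Hi [Hx _]; apply Hb; assumption.
  - intros l x y Hl [Gx Px] [Gy Py]; split; [apply Hc; assumption|].
    rewrite dot_comb; apply HP; assumption.
Qed.

Lemma interval_co a b : interval (fun s => a <= s < b).
Proof. intros l s t Hl Hs Ht; nra. Qed.

Lemma interval_oc a b : interval (fun s => a < s <= b).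
Proof. intros l s t Hl Hs Ht; nra. Qed.

Lemma gsum_slab_opp n k G xi P : (forall x, G x -> G (fun i => - x i)) ->
  gsum n k (ind (slab n G xi P)) = gsum n k (ind (slab n G xi (fun s => P (- s)))).
Proof.
  intros Hs; rewrite <- gsum_opp; apply gsum_ext; intros x.
  assert (E : slab n G xi P (fun i => - x i) <-> slab n G xi (fun s => P (- s)) x).
  { unfold slab; rewrite dot_opp, (opp_mem G x Hs); tauto. }
  unfold ind; do 2 destruct excluded_middle_informative; tauto.
Qed.

Definition slab_vol n G xi dl t := vol n (slab n G xi (fun s => t <= s < t + dl)).

Section slabs.
Context (n : nat) (rad : R) (G : vec -> Prop) (HG : symmetric_body n rad G).
Context (xi : vec) (dl : R) (Hdl : 0 < dl).
Let V := slab_vol n G xi dl.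
(** The discrete substitute for the density of the linear form on the nonnegative half-line,
    multiplied by [dl]. *)
Let a (i : nat) := V (dl * INR i).

Lemma slab_vol_nonneg t : 0 <= V t.
Proof. apply (vol_nonneg n rad), slab_cb, interval_co; apply HG. Qed.

Lemma slab_vol_log_concave l s t : 0 < l < 1 -> 0 < V s -> 0 < V t ->
  gmean l (V s) (V t) <= V (l * s + (1 - l) * t).
Proof.
  intros Hl; apply (brunn_minkowski n rad); auto;
    try (apply slab_cb, interval_co; apply HG).
  intros x y [Gx Px] [Gy Py]; split; [apply HG; assumption|].
  rewrite dot_comb; nra.
Qed.

(* The slab at [u] and its mirror image bound the slab at [w] from below, because
   their convex combinations fall in it for a suitable weight. *)
Lemma slab_vol_decr w u : 0 <= w <= u -> V u <= V w.
Proof.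
  intros [Hw [Hu| ->]]; [|lra].
  destruct (slab_vol_nonneg u) as [Pu|E]; [|rewrite <- E; apply slab_vol_nonneg].
  (* The weight solves [l * u + (1 - l) * (- u - dl) = w]. It then also sends the upper ends
     [u + dl] and [- u] to [w + dl], so combinations of the two slabs stay in the slab at [w]. *)
  set (l := (w + u + dl) / (2 * u + dl)).
  assert (Hl : 0 < l < 1).
  { unfold l; split; [apply Rdiv_lt_0_compat; lra|].
    apply Rmult_lt_reg_r with (2 * u + dl); [lra|].
    unfold Rdiv; rewrite Rmult_assoc, Rinv_l by lra; lra. }
  assert (El : l * (2 * u + dl) = w + u + dl) by (unfold l; field; lra).
  set (B := slab n G xi (fun s => - u - dl < s <= - u)).
  assert (EB : vol n B = V u).
  { symmetry; apply gint_eq; apply (Un_cv_ext (fun k => gsum n k (ind B))).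
    - intros k; unfold B; rewrite gsum_slab_opp by apply HG.
      apply gsum_ext; intros x; apply Rle_antisym; apply ind_le; unfold slab; intros []; split; lra || assumption.
    - apply (vol_cv n rad), slab_cb, interval_oc; apply HG. }
  rewrite <- (gmean_diag l (V u) Pu); rewrite <- EB at 2.
  apply (brunn_minkowski n rad); auto; try (rewrite EB; exact Pu);
    try (apply slab_cb; [apply HG|apply interval_co || apply interval_oc]).
  intros x y [Gx Px] [Gy Py]; split; [apply HG; assumption|].
  rewrite dot_comb; nra.
Qed.

Lemma slab_seq_decr i : a (S i) <= a i.
Proof.
  unfold a; apply slab_vol_decr; rewrite S_INR; pose proof (pos_INR i); nra.
Qed.

(** [i] and [k] are convex combinations of [i + k] and 0 with complementary weights; multiplying the
    two log-concavity inequalities removes the exponents. In ratio form, a shift by [k] multiplies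
    the volumes by at most [a k / a 0]. *)
Lemma slab_seq_log_concave i k : a (i + k) * a 0%nat <= a i * a k.
Proof.
  destruct i as [|i]; [simpl; lra|]; destruct k as [|k]; [rewrite Nat.add_0_r; lra|].
  set (I := S i); set (K := S k).
  assert (Np : forall j, 0 <= a j) by (intros; apply slab_vol_nonneg).
  destruct (Np (I + K)%nat) as [P1|E]; [|rewrite <- E, Rmult_0_l; apply Rmult_le_pos; apply Np].
  destruct (Np 0%nat) as [P2|E]; [|rewrite <- E, Rmult_0_r; apply Rmult_le_pos; apply Np].
  assert (HI : 0 < INR I) by (apply lt_0_INR; unfold I; lia).
  assert (HK : 0 < INR K) by (apply lt_0_INR; unfold K; lia).
  set (l := INR I / (INR I + INR K)).
  assert (Hl : 0 < l < 1).
  { unfold l; split; [apply Rdiv_lt_0_compat; lra|].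
    apply Rmult_lt_reg_r with (INR I + INR K); [lra|].
    unfold Rdiv; rewrite Rmult_assoc, Rinv_l by lra; lra. }
  assert (Q1 := slab_vol_log_concave l _ _ Hl P1 P2).
  assert (Q2 := slab_vol_log_concave (1 - l) _ _ ltac:(lra) P1 P2).
  replace (l * (dl * INR (I + K)) + (1 - l) * (dl * INR 0)) with (dl * INR I) in Q1.
  2:{ unfold l; rewrite plus_INR; simpl (INR 0); field; lra. }
  replace ((1 - l) * (dl * INR (I + K)) + (1 - (1 - l)) * (dl * INR 0)) with (dl * INR K) in Q2.
  2:{ unfold l; rewrite plus_INR; simpl (INR 0); field; lra. }
  fold (a (I + K)) (a 0) (a I) in Q1; fold (a (I + K)) (a 0) (a K) in Q2.
  replace (a (I + K) * a 0%nat)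
    with (gmean l (a (I + K)%nat) (a 0%nat) * gmean (1 - l) (a (I + K)%nat) (a 0%nat)).
  - apply Rmult_le_compat; auto; left; apply gmean_pos.
  - unfold gmean; rewrite <- exp_plus.
    replace (l * ln (a (I + K)%nat) + (1 - l) * ln (a 0%nat) +
      ((1 - l) * ln (a (I + K)%nat) + (1 - (1 - l)) * ln (a 0%nat)))
      with (ln (a (I + K)%nat) + ln (a 0%nat)) by ring.
    rewrite exp_plus, !exp_ln by assumption; reflexivity.
Qed.

Let cell (i : nat) := slab n G xi (fun s => dl * INR i <= s < dl * INR i + dl).

Lemma cell_cv i : Un_cv (fun k => gsum n k (ind (cell i))) (a i).
Proof. apply (vol_cv n rad), slab_cb, interval_co; apply HG. Qed.

Lemma cell_step (c : nat -> R) m x :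
  (exists u, (u < m)%nat /\ cell u x /\ rsum m (fun i => c i * ind (cell i) x) = c u) \/
  (~ (G x /\ 0 <= dot n x xi < dl * INR m) /\ rsum m (fun i => c i * ind (cell i) x) = 0).
Proof.
  destruct (excluded_middle_informative (G x /\ 0 <= dot n x xi < dl * INR m)) as [[Gx Hx]|Hn].
  - left; destruct (grid_cell m 0 dl (dot n x xi) Hdl ltac:(lra)) as [u [Hu Hb]].
    rewrite S_INR in Hb.
    exists u; split; [exact Hu|split; [split; [exact Gx|lra]|]].
    rewrite (rsum_split_at m u) by exact Hu.
    rewrite (ind_in (cell u)) by (split; [exact Gx|lra]).
    rewrite !rsum_zero; [ring| |].
    + intros i Hi; rewrite ind_out; [ring|]; intros [_ [H1 _]].
      replace (u + 1 + i)%nat with (S (u + i)) in H1 by lia.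
      rewrite S_INR, plus_INR in H1; pose proof (pos_INR i); nra.
    + intros i Hi; rewrite ind_out; [ring|]; intros [_ [_ H1]].
      replace (u - 1 - i)%nat with (u - S i)%nat in H1 by lia.
      rewrite minus_INR, S_INR in H1 by lia; pose proof (pos_INR i); nra.
  - right; split; [exact Hn|]; apply rsum_zero; intros i Hi.
    rewrite ind_out; [ring|]; intros [Gx [H1 H2]]; apply Hn; split; [exact Gx|].
    assert (INR i + 1 <= INR m) by (rewrite <- S_INR; apply le_INR; lia).
    pose proof (pos_INR i); nra.
Qed.

Lemma cell_sum_cv c m :
  Un_cv (fun k => gsum n k (fun x => rsum m (fun i => c i * ind (cell i) x)))
        (rsum m (fun i => c i * a i)).
Proof.
  apply (Un_cv_ext (fun k => rsum m (fun i => c i * gsum n k (ind (cell i))))).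
  - intros k; rewrite gsum_rsum; apply rsum_ext; intros; rewrite gsum_scal; reflexivity.
  - induction m as [|m IH]; simpl; [apply Un_cv_const|].
    apply CV_plus; [exact IH|]; apply CV_mult; [apply Un_cv_const|apply cell_cv].
Qed.

Lemma slab_seq_mass m : rsum m a <= 1.
Proof.
  rewrite (rsum_ext m a (fun i => 1 * a i)) by (intros; ring).
  apply (Un_cv_le _ _ _ _ 0) with (2 := cell_sum_cv (fun _ => 1) m) (3 := sb_vol _ _ _ HG).
  intros k _; apply gsum_le; intros x.
  destruct (cell_step (fun _ => 1) m x) as [[u [_ [[Gx _] ->]]]|[_ ->]].
  - rewrite ind_in by exact Gx; lra.
  - apply ind_bounds.
Qed.

(** The restriction to the half of [G] on which the slab volumes decrease, the bounding hyperplane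
    included. *)
Definition half g (x : vec) := ind (slab n G xi (fun s => 0 <= s)) x * g (dot n x xi).

Lemma half_le_step (g : R -> R) c m S0 k : (forall x, G x -> Rabs (dot n x xi) <= S0) ->
  S0 < dl * INR m ->
  (forall i s, dl * INR i <= s < dl * INR i + dl -> s <= S0 -> g s <= c i) ->
  gsum n k (half g) <= gsum n k (fun x => rsum m (fun i => c i * ind (cell i) x)).
Proof.
  intros HS Hm Hg; apply gsum_le; intros x; unfold half.
  destruct (cell_step c m x) as [[u [_ [[Gx Ix] ->]]]|[Hn ->]].
  - pose proof (pos_INR u).
    rewrite ind_in by (split; [exact Gx|nra]); rewrite Rmult_1_l; apply Hg; [exact Ix|].
    apply HS, Rabs_bounds in Gx; lra.
  - rewrite ind_out; [lra|]; intros [Gx Hx]; apply Hn; split; [exact Gx|].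
    apply HS, Rabs_bounds in Gx; lra.
Qed.

Lemma half_upper (g : R -> R) c m S0 X : (forall x, G x -> Rabs (dot n x xi) <= S0) ->
  S0 < dl * INR m ->
  (forall i s, dl * INR i <= s < dl * INR i + dl -> s <= S0 -> g s <= c i) ->
  Un_cv (fun k => gsum n k (half g)) X -> X <= rsum m (fun i => c i * a i).
Proof.
  intros HS Hm Hg HX.
  apply (Un_cv_le _ _ _ _ 0) with (2 := HX) (3 := cell_sum_cv c m).
  intros k _; apply (half_le_step g c m S0); assumption.
Qed.

(** On each cell a Lipschitz [g] stays within [K * dl] of its value at the left end, and the cells
    have total volume at most 1. The upper bound is applied to [g] and to [- g]. *)
Lemma half_near (g : R -> R) K m S0 X : (forall x, G x -> Rabs (dot n x xi) <= S0) ->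
  S0 < dl * INR m -> 0 <= K ->
  (forall s t, 0 <= s <= S0 -> 0 <= t <= S0 -> Rabs (g s - g t) <= K * Rabs (s - t)) ->
  Un_cv (fun k => gsum n k (half g)) X ->
  Rabs (X - rsum m (fun i => g (dl * INR i) * a i)) <= K * dl.
Proof.
  intros HS Hm HK Hg HX.
  assert (L : forall i s, dl * INR i <= s < dl * INR i + dl -> s <= S0 ->
    Rabs (g s - g (dl * INR i)) <= K * dl).
  { intros i s Hs HsS.
    assert (0 <= dl * INR i) by (apply Rmult_le_pos; [lra|apply pos_INR]).
    eapply Rle_trans; [apply Hg; lra|].
    apply Rmult_le_compat_l; [exact HK|]; rewrite Rabs_pos_eq; lra. }
  assert (Mass := slab_seq_mass m).
  assert (U := half_upper g (fun i => g (dl * INR i) + K * dl) m S0 X HS Hm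
    ltac:(cbv beta; intros i s H1 H2; specialize (L i s H1 H2); apply Rabs_bounds in L; lra) HX).
  assert (HX' : Un_cv (fun k => gsum n k (half (fun s => - g s))) (- X)).
  { apply (Un_cv_ext (fun k => -1 * gsum n k (half g))).
    - intros k; rewrite <- gsum_scal; apply gsum_ext; intros; unfold half; ring.
    - replace (- X) with (-1 * X) by ring; apply CV_mult; [apply Un_cv_const|exact HX]. }
  assert (U' := half_upper (fun s => - g s) (fun i => - g (dl * INR i) + K * dl) m S0 _ HS Hm
    ltac:(cbv beta; intros i s H1 H2; specialize (L i s H1 H2); apply Rabs_bounds in L; lra) HX').
  cbv beta in U, U'.
  rewrite (rsum_ext m (fun i => (g (dl * INR i) + K * dl) * a i)
    (fun i => g (dl * INR i) * a i + K * dl * a i)) in U by (intros; ring).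
  rewrite (rsum_ext m (fun i => (- g (dl * INR i) + K * dl) * a i)
    (fun i => -1 * (g (dl * INR i) * a i) + K * dl * a i)) in U' by (intros; ring).
  rewrite rsum_plus, rsum_scal in U.
  rewrite rsum_plus, !rsum_scal in U'.
  assert (K * dl * rsum m a <= K * dl * 1) by (apply Rmult_le_compat_l; [nra|exact Mass]).
  apply Rabs_le; split; lra.
Qed.

End slabs.

(** * Summation by parts over slabs *)

Lemma cv_of_squeeze u :
  (forall e, 0 < e -> exists v w A B, Un_cv v A /\ Un_cv w B /\ B - A <= e /\
     forall k, v k <= u k <= w k) -> exists X, Un_cv u X.
Proof.
  intros H; destruct (R_complete u) as [X HX]; [|exists X; exact HX].
  intros e He; destruct (H (e / 4) ltac:(lra)) as [v [w [A [B [Hv [Hw [HAB Hu]]]]]]].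
  destruct (Hv (e / 4) ltac:(lra)) as [N1 H1]; destruct (Hw (e / 4) ltac:(lra)) as [N2 H2].
  exists (N1 + N2)%nat; intros k l Hk Hl; unfold Rdist in *.
  pose proof (H1 k ltac:(lia)) as a1; pose proof (H1 l ltac:(lia)) as a2.
  pose proof (H2 k ltac:(lia)) as b1; pose proof (H2 l ltac:(lia)) as b2.
  apply Rabs_def2 in a1; apply Rabs_def2 in a2; apply Rabs_def2 in b1; apply Rabs_def2 in b2.
  pose proof (Hu k); pose proof (Hu l); apply Rabs_def1; lra.
Qed.

Lemma steps_beyond dl S0 : 0 < dl -> exists m0, forall m, (m0 <= m)%nat -> S0 < dl * INR m.
Proof.
  intros Hd; destruct (INR_unbounded (S0 / dl)) as [m0 H0]; exists m0; intros m Hm.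
  apply le_INR in Hm.
  apply Rmult_lt_reg_l with (/ dl); [apply Rinv_0_lt_compat; assumption|].
  rewrite <- Rmult_assoc, Rinv_l, Rmult_1_l by lra; unfold Rdiv in H0; lra.
Qed.

Definition lipschitz_on (S0 K : R) (g : R -> R) : Prop :=
  forall s t, 0 <= s <= S0 -> 0 <= t <= S0 -> Rabs (g s - g t) <= K * Rabs (s - t).

(** [g] need not be log-concave, so convergence is not given by [gint_cv]. Step functions on slabs
    enclose [g] and have convergent grid sums, with limits at most [2 * K * dl] apart. *)
Lemma half_cv n rad G xi g S0 K : symmetric_body n rad G ->
  (forall x, G x -> Rabs (dot n x xi) <= S0) -> 0 <= K -> lipschitz_on S0 K g ->
  exists X, Un_cv (fun k => gsum n k (half n G xi g)) X.
Proof.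
  intros HG HS HK Hg; apply cv_of_squeeze; intros e He.
  set (dl := e / (2 * (K + 1))).
  assert (Hd : 0 < dl) by (apply Rdiv_lt_0_compat; lra).
  destruct (steps_beyond dl S0 Hd) as [m Hm]; specialize (Hm m (le_n _)).
  assert (L : forall i s, dl * INR i <= s < dl * INR i + dl -> s <= S0 ->
    Rabs (g s - g (dl * INR i)) <= K * dl).
  { intros i s Hs HsS.
    assert (0 <= dl * INR i) by (apply Rmult_le_pos; [lra|apply pos_INR]).
    eapply Rle_trans; [apply Hg; lra|].
    apply Rmult_le_compat_l; [exact HK|]; rewrite Rabs_pos_eq; lra. }
  set (cell := fun i => slab n G xi (fun s => dl * INR i <= s < dl * INR i + dl)).
  exists (fun k => -1 * gsum n k (fun x => rsum m (fun i => (- g (dl * INR i) + K * dl) * ind (cell i) x))).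
  exists (fun k => gsum n k (fun x => rsum m (fun i => (g (dl * INR i) + K * dl) * ind (cell i) x))).
  eexists; eexists; split; [|split; [|split]].
  - apply CV_mult; [apply Un_cv_const|].
    exact (cell_sum_cv n rad G HG xi dl (fun i => - g (dl * INR i) + K * dl) m).
  - exact (cell_sum_cv n rad G HG xi dl (fun i => g (dl * INR i) + K * dl) m).
  - cbv beta; set (a := fun i => slab_vol n G xi dl (dl * INR i)).
    change (fun i => (g (dl * INR i) + K * dl) * slab_vol n G xi dl (dl * INR i))
      with (fun i => (g (dl * INR i) + K * dl) * a i).
    change (fun i => (- g (dl * INR i) + K * dl) * slab_vol n G xi dl (dl * INR i))
      with (fun i => (- g (dl * INR i) + K * dl) * a i).
    assert (M := slab_seq_mass n rad G HG xi dl Hd m); fold a in M.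
    replace (rsum m (fun i => (g (dl * INR i) + K * dl) * a i) -
      -1 * rsum m (fun i => (- g (dl * INR i) + K * dl) * a i)) with (2 * (K * dl) * rsum m a).
    2:{ rewrite <- !rsum_scal.
        replace (rsum m (fun i => (g (dl * INR i) + K * dl) * a i) -
          rsum m (fun i => -1 * ((- g (dl * INR i) + K * dl) * a i)))
        with (rsum m (fun i => (g (dl * INR i) + K * dl) * a i) + -1 *
          rsum m (fun i => -1 * ((- g (dl * INR i) + K * dl) * a i))) by ring.
        rewrite <- rsum_scal, <- rsum_plus; apply rsum_ext; intros; ring. }
    assert (E : 2 * (K + 1) * dl = e) by (unfold dl; field; lra).
    assert (0 <= 2 * (K * dl)) by nra.
    apply Rle_trans with (2 * (K * dl) * 1); [apply Rmult_le_compat_l; assumption|nra].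
  - intros k.
    assert (U := half_le_step n G xi dl Hd g (fun i => g (dl * INR i) + K * dl) m S0 k HS Hm
      ltac:(cbv beta; intros i s H1 H2; specialize (L i s H1 H2); apply Rabs_bounds in L; lra)).
    assert (U' := half_le_step n G xi dl Hd (fun s => - g s) (fun i => - g (dl * INR i) + K * dl)
      m S0 k HS Hm
      ltac:(cbv beta; intros i s H1 H2; specialize (L i s H1 H2); apply Rabs_bounds in L; lra)).
    change (gsum n k (half n G xi (fun s => - g s)) <=
      gsum n k (fun x => rsum m (fun i => (- g (dl * INR i) + K * dl) * ind (cell i) x))) in U'.
    replace (gsum n k (half n G xi (fun s => - g s))) with (-1 * gsum n k (half n G xi g)) in U'.
    2:{ rewrite <- gsum_scal; apply gsum_ext; intros; unfold half; ring. }
    cbv beta; split; [lra|exact U].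
Qed.

(** Reflection maps one half to the other and counts the hyperplane twice. For fixed [k] it may
    contain many grid points, so its sum has to be subtracted. *)
Lemma gsum_even n k G xi (g : R -> R) : (forall x, G x -> G (fun i => - x i)) ->
  (forall s, g (- s) = g s) ->
  gsum n k (fun x => ind G x * g (dot n x xi))
  = 2 * gsum n k (half n G xi g) + - g 0 * gsum n k (ind (slab n G xi (fun s => 0 <= s <= 0))).
Proof.
  intros Hs He.
  set (neg := fun x => ind (slab n G xi (fun s => s < 0)) x * g (dot n x xi)).
  assert (E1 : gsum n k (fun x => ind G x * g (dot n x xi))
    = gsum n k (half n G xi g) + gsum n k neg).
  { rewrite <- gsum_plus; apply gsum_ext; intros x; unfold half, neg.
    rewrite <- Rmult_plus_distr_r; f_equal; unfold ind, slab.
    repeat destruct excluded_middle_informative; try lra; exfalso; intuition lra. }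
  assert (E2 : gsum n k neg = gsum n k (half n G xi g) +
    - g 0 * gsum n k (ind (slab n G xi (fun s => 0 <= s <= 0)))).
  { rewrite <- gsum_opp, <- gsum_scal, <- gsum_plus; apply gsum_ext; intros x.
    unfold neg, half; rewrite dot_opp, He.
    pose proof (opp_mem G x Hs) as Gx.
    unfold ind, slab; rewrite dot_opp.
    repeat destruct excluded_middle_informative; try lra; try (exfalso; intuition lra).
    replace (dot n x xi) with 0 by (intuition lra); ring. }
  rewrite E1, E2; ring.
Qed.

(** * Summation by parts against a decreasing sequence *)

Lemma rsum_by_parts m (a w : nat -> R) :
  rsum m (fun i => a i * w i)
  = a m * rsum m w + rsum m (fun i => (a i - a (S i)) * rsum (S i) w).
Proof.
  induction m as [|m IH]; [simpl; ring|].
  change (rsum m (fun i => a i * w i) + a m * w m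
    = a (S m) * (rsum m w + w m) + (rsum m (fun i => (a i - a (S i)) * rsum (S i) w)
      + (a m - a (S m)) * (rsum m w + w m))).
  rewrite IH; ring.
Qed.

(** In Abel's formula the coefficients [a m] and [a i - a (S i)] are nonnegative, so domination of
    partial sums passes to the weighted sums. The choice of [q] yields the two bounds that
    follow. *)
Lemma rsum_by_parts_bound m (a w q : nat -> R) :
  (forall i, 0 <= a i) -> (forall i, a (S i) <= a i) ->
  (forall j, Rabs (rsum j w) <= rsum j q) ->
  Rabs (rsum m (fun i => a i * w i)) <= rsum m (fun i => a i * q i).
Proof.
  intros H0 Hd Hq; rewrite (rsum_by_parts m a w), (rsum_by_parts m a q).
  eapply Rle_trans; [apply Rabs_triang|]; apply Rplus_le_compat.
  - rewrite Rabs_mult, (Rabs_pos_eq (a m)) by apply H0.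
    apply Rmult_le_compat_l; [apply H0|apply Hq].
  - eapply Rle_trans; [apply rsum_abs|]; apply rsum_le; intros i _.
    assert (0 <= a i - a (S i)) by (specialize (Hd i); lra).
    rewrite Rabs_mult, (Rabs_pos_eq (a i - a (S i))) by assumption.
    apply Rmult_le_compat_l; [assumption|apply Hq].
Qed.

Lemma rsum_decr_mult_bound m (a v : nat -> R) W :
  (forall i, 0 <= a i) -> (forall i, a (S i) <= a i) ->
  (forall j, Rabs (rsum j v) <= W) ->
  Rabs (rsum m (fun i => a i * v i)) <= W * a 0%nat.
Proof.
  intros H0 Hd HW.
  assert (W0 : 0 <= W) by (specialize (HW 0%nat); simpl in HW; rewrite Rabs_R0 in HW; exact HW).
  eapply Rle_trans.
  (* The dominating sequence carries all its mass [W] at index 0, so only [a 0] remains. *)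
  - apply (rsum_by_parts_bound m a v (fun i => if Nat.eqb i 0 then W else 0)); auto.
    intros [|j]; [simpl; rewrite Rabs_R0; lra|].
    rewrite (rsum_shift j (fun i => if Nat.eqb i 0 then W else 0)); cbn [Nat.eqb].
    rewrite rsum_const; specialize (HW (S j)); lra.
  - destruct m as [|m]; [simpl; specialize (H0 0%nat); nra|].
    rewrite rsum_shift; cbn [Nat.eqb]; rewrite rsum_zero; [lra|intros; ring].
Qed.

(** The dominating sequence is the constant [2 * W]: a second summation by parts bounds the partial
    sums of [INR i * v i] by [2 * W * INR j]. This is the discrete form of the bound for the
    integral of |s f'(s)| by the mass. *)
Lemma rsum_index_mult_bound m (a v : nat -> R) W :
  (forall i, 0 <= a i) -> (forall i, a (S i) <= a i) ->
  (forall j, Rabs (rsum j v) <= W) ->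
  Rabs (rsum m (fun i => a i * (INR i * v i))) <= 2 * W * rsum m a.
Proof.
  intros H0 Hd HW.
  rewrite <- rsum_scal, (rsum_ext m (fun i => 2 * W * a i) (fun i => a i * (2 * W)))
    by (intros; ring).
  apply (rsum_by_parts_bound m a (fun i => INR i * v i) (fun _ => 2 * W)); auto.
  intros j; rewrite rsum_const, (rsum_by_parts j INR v).
  eapply Rle_trans; [apply Rabs_triang|].
  assert (Rabs (INR j * rsum j v) <= INR j * W).
  { rewrite Rabs_mult, Rabs_pos_eq by apply pos_INR.
    apply Rmult_le_compat_l; [apply pos_INR|apply HW]. }
  assert (Rabs (rsum j (fun i => (INR i - INR (S i)) * rsum (S i) v)) <= INR j * W); [|lra].
  eapply Rle_trans; [apply rsum_abs|]; rewrite <- rsum_const; apply rsum_le; intros i _.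
  rewrite S_INR; replace (INR i - (INR i + 1)) with (-(1)) by ring.
  rewrite Rabs_mult, Rabs_Ropp, Rabs_R1, Rmult_1_l; apply HW.
Qed.

(** * Trigonometric inequalities and sums *)

Lemma sin_abs_le x : Rabs (sin x) <= Rabs x.
Proof.
  destruct (Rtotal_order x 0) as [H|[->|H]].
  - assert (P := sin_lt_x (- x) ltac:(lra)); rewrite sin_neg in P.
    rewrite (Rabs_left x H); apply Rabs_le; split; [lra|].
    destruct (Rle_dec (- PI) x) as [Hp|Hp].
    + assert (sin x <= 0); [|lra].
      assert (0 <= sin (- x)) by (apply sin_ge_0; lra); rewrite sin_neg in *; lra.
    + pose proof (SIN_bound x); pose proof PI2_1; lra.
  - rewrite sin_0; lra.
  - assert (P := sin_lt_x x H); rewrite (Rabs_pos_eq x) by lra; apply Rabs_le; split; [|lra].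
    destruct (Rle_dec x PI) as [Hp|Hp].
    + assert (0 <= sin x) by (apply sin_ge_0; lra); lra.
    + pose proof (SIN_bound x); pose proof PI2_1; lra.
Qed.

Lemma cos_lipschitz x y : Rabs (cos x - cos y) <= Rabs (x - y).
Proof.
  rewrite form2; replace (-2) with (- (2)) by ring.
  rewrite !Rabs_mult, Rabs_Ropp, (Rabs_pos_eq 2) by lra.
  pose proof (sin_abs_le ((x - y) / 2)) as H.
  assert (Hs : Rabs (sin ((x + y) / 2)) <= 1) by (apply Rabs_le, SIN_bound).
  replace (Rabs (x - y)) with (2 * Rabs ((x - y) / 2)).
  2:{ rewrite <- (Rabs_pos_eq 2) at 1 by lra; rewrite <- Rabs_mult; f_equal; field. }
  pose proof (Rabs_pos (sin ((x - y) / 2))); pose proof (Rabs_pos (sin ((x + y) / 2))); nra.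
Qed.

Lemma sin_lipschitz x y : Rabs (sin x - sin y) <= Rabs (x - y).
Proof.
  rewrite <- !cos_shift.
  eapply Rle_trans; [apply cos_lipschitz|].
  replace (PI / 2 - x - (PI / 2 - y)) with (- (x - y)) by ring; rewrite Rabs_Ropp; lra.
Qed.

Lemma sin_ge_half x : 0 < x <= PI / 3 -> x / 2 <= sin x.
Proof.
  intros Hx.
  destruct (MVT_cor2 sin cos 0 x ltac:(lra)) as [c [Hc Hc']].
  { intros; apply derivable_pt_lim_sin. }
  rewrite sin_0 in Hc.
  assert (cos (PI / 3) <= cos c) by (apply cos_decr_1; lra).
  rewrite cos_PI3 in *; nra.
Qed.

(** Multiplication by [2 * sin t], with [t] half the angle step, makes the sum telescope. The
    condition [dl <= / 3] puts [t] in [(0, PI / 3]], where [sin t >= t / 2 >= dl]. *)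
Lemma sum_cos_bound dl j : 0 < dl <= / 3 ->
  Rabs (rsum j (fun i => cos (2 * PI * (dl * INR i)))) <= / dl.
Proof.
  intros Hd; pose proof PI2_1 as HP; set (t := PI * dl).
  assert (Ht : t / 2 <= sin t) by (apply sin_ge_half; unfold t; nra).
  assert (dt : dl <= t / 2) by (unfold t; nra).
  assert (E : 2 * sin t * rsum j (fun i => cos (2 * PI * (dl * INR i)))
    = sin (2 * t * INR j - t) + sin t).
  { induction j as [|j IH].
    - simpl; replace (2 * t * 0 - t) with (- t) by ring; rewrite sin_neg; ring.
    - rewrite S_INR; simpl rsum; rewrite Rmult_plus_distr_l, IH.
      replace (2 * t * (INR j + 1) - t) with (2 * t * INR j + t) by ring.
      replace (2 * PI * (dl * INR j)) with (2 * t * INR j) by (unfold t; ring).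
      rewrite sin_plus, sin_minus; ring. }
  apply Rmult_le_reg_l with (2 * sin t); [lra|].
  rewrite <- (Rabs_pos_eq (2 * sin t)) at 1 by lra.
  rewrite <- Rabs_mult, E.
  apply Rle_trans with 2.
  - apply Rabs_le; pose proof (SIN_bound (2 * t * INR j - t)); pose proof (SIN_bound t); lra.
  - apply Rmult_le_reg_r with dl; [lra|]; rewrite Rmult_assoc, Rinv_l by lra; lra.
Qed.

Lemma sum_sin_bound dl j : 0 < dl <= / 3 ->
  Rabs (rsum j (fun i => sin (2 * PI * (dl * INR i)))) <= / dl.
Proof.
  intros Hd; pose proof PI2_1 as HP; set (t := PI * dl).
  assert (Ht : t / 2 <= sin t) by (apply sin_ge_half; unfold t; nra).
  assert (dt : dl <= t / 2) by (unfold t; nra).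
  assert (E : 2 * sin t * rsum j (fun i => sin (2 * PI * (dl * INR i)))
    = cos t - cos (2 * t * INR j - t)).
  { induction j as [|j IH].
    - simpl; replace (2 * t * 0 - t) with (- t) by ring; rewrite cos_neg; ring.
    - rewrite S_INR; simpl rsum; rewrite Rmult_plus_distr_l, IH.
      replace (2 * t * (INR j + 1) - t) with (2 * t * INR j + t) by ring.
      replace (2 * PI * (dl * INR j)) with (2 * t * INR j) by (unfold t; ring).
      rewrite cos_plus, cos_minus; ring. }
  apply Rmult_le_reg_l with (2 * sin t); [lra|].
  rewrite <- (Rabs_pos_eq (2 * sin t)) at 1 by lra.
  rewrite <- Rabs_mult, E.
  apply Rle_trans with 2.
  - apply Rabs_le; pose proof (COS_bound (2 * t * INR j - t)); pose proof (COS_bound t); lra.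
  - apply Rmult_le_reg_r with dl; [lra|]; rewrite Rmult_assoc, Rinv_l by lra; lra.
Qed.

(* For k at scale sigma/3: if [a k <= a 0 / 4] then, by log-concavity, shifting by k steps
   costs a factor 4, so the second moment is at most that of a geometric tail at scale
   sigma/3, which is too small. Hence a stays above [a 0 / 4] on k cells. *)
Lemma central_slab_bound n rad G xi sg k : symmetric_body n rad G -> 0 < sg ->
  Un_cv (fun j => gsum n j (half n G xi (fun s => s ^ 2))) (sg ^ 2 / 2) -> (0 < k)%nat ->
  slab_vol n G xi (sg / (3 * INR k)) 0 <= 4 / INR k.
Proof.
  intros HG Hs HM Hk.
  assert (Hk' : 0 < INR k) by (apply lt_0_INR; exact Hk).
  set (dl := sg / (3 * INR k)).
  assert (Hd : 0 < dl) by (apply Rdiv_lt_0_compat; lra).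
  assert (Ek : dl * INR k = sg / 3) by (unfold dl; field; lra).
  set (a := fun i => slab_vol n G xi dl (dl * INR i)).
  assert (a0 : forall i, 0 <= a i) by (intros; apply (slab_vol_nonneg n rad), HG).
  assert (ad : forall i, a (S i) <= a i) by (intros; apply (slab_seq_decr n rad); assumption).
  assert (am : forall m, rsum m a <= 1) by (intros; apply (slab_seq_mass n rad); assumption).
  assert (al : forall i j, a (i + j)%nat * a 0%nat <= a i * a j)
    by (intros; apply (slab_seq_log_concave n rad); assumption).
  replace (slab_vol n G xi dl 0) with (a 0%nat) by (unfold a; simpl; f_equal; ring).
  destruct (Rle_dec (a 0%nat) (4 / INR k)) as [|Hn]; [assumption|exfalso].
  assert (Hn' : 4 < a 0%nat * INR k).
  { apply Rnot_le_lt in Hn; apply (Rmult_lt_compat_r (INR k)) in Hn; [|exact Hk'].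
    unfold Rdiv in Hn; rewrite Rmult_assoc, Rinv_l in Hn by lra; lra. }
  assert (P0 : 0 < a 0%nat) by nra.
  destruct (Rle_dec (a k) (a 0%nat / 4)) as [Hq|Hq].
  - destruct (dot_bounded n rad G xi (sb_cb _ _ _ HG)) as [S0 [_ HS]].
    destruct (steps_beyond dl S0 Hd) as [m0 Hm0].
    (* The supremum of [s ^ 2] on cell [i]. *)
    set (c := fun i => (dl * INR i + dl) ^ 2).
    set (M := rsum (k + m0) (fun i => c i * a i)).
    assert (HMc : sg ^ 2 / 2 <= M).
    { unfold M; apply (half_upper n rad G HG xi dl Hd (fun s => s ^ 2) c (k + m0) S0);
        auto; [apply Hm0; lia|].
      intros i s Hi _; unfold c; pose proof (pos_INR i); apply pow_incr.
      split; [|lra]; assert (0 <= dl * INR i) by (apply Rmult_le_pos; lra); lra. }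
    assert (Q : forall i, a (k + i)%nat <= a i / 4).
    { intros i; specialize (al i k); rewrite (Nat.add_comm i k) in al.
      apply Rmult_le_reg_r with (a 0%nat); [exact P0|].
      pose proof (a0 i); nra. }
    assert (A : rsum k (fun i => c i * a i) <= (sg / 3) ^ 2 * rsum k a).
    { rewrite <- rsum_scal; apply rsum_le; intros i Hi.
      apply Rmult_le_compat_r; [apply a0|]; unfold c.
      assert (INR i + 1 <= INR k) by (rewrite <- S_INR; apply le_INR; lia).
      pose proof (pos_INR i); apply pow_incr; rewrite <- Ek; nra. }
    assert (B : rsum m0 (fun i => c (k + i)%nat * a (k + i)%nat)
      <= / 2 * rsum m0 (fun i => c i * a i) + / 2 * (sg / 3) ^ 2 * rsum m0 a).
    { rewrite <- !rsum_scal, <- rsum_plus; apply rsum_le; intros i _.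
      apply Rle_trans with (c (k + i)%nat * (a i / 4)).
      - apply Rmult_le_compat_l; [apply pow2_ge_0|apply Q].
      - assert (c (k + i)%nat <= 2 * c i + 2 * (sg / 3) ^ 2).
        { unfold c; rewrite plus_INR, <- Ek; set (u := dl * INR i + dl); set (v := dl * INR k).
          replace (dl * (INR k + INR i) + dl) with (u + v) by (unfold u, v; ring).
          pose proof (pow2_ge_0 (u - v)); nra. }
        pose proof (a0 i); nra. }
    assert (Ms : M = rsum k (fun i => c i * a i) + rsum m0 (fun i => c (k + i)%nat * a (k + i)%nat))
      by apply rsum_app.
    assert (Mm : rsum m0 (fun i => c i * a i) <= M).
    { unfold M; rewrite Nat.add_comm, rsum_app.
      assert (0 <= rsum k (fun i => c (m0 + i)%nat * a (m0 + i)%nat)); [|lra].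
      apply rsum_nonneg; intros; apply Rmult_le_pos; [apply pow2_ge_0|apply a0]. }
    (* With masses at most 1 the estimates give M <= sg^2/9 + M/2 + sg^2/18, that is M <= sg^2/3,
       against M >= sg^2/2. *)
    pose proof (am k) as amk; pose proof (am m0) as amm.
    assert (0 < sg ^ 2) by (apply pow_lt; exact Hs).
    replace ((sg / 3) ^ 2) with (sg ^ 2 / 9) in * by field.
    assert (sg ^ 2 / 9 * rsum k a <= sg ^ 2 / 9) by nra.
    assert (/ 2 * (sg ^ 2 / 9) * rsum m0 a <= / 2 * (sg ^ 2 / 9)) by nra.
    lra.
  (* Here the first [k] cells each have volume above [a 0 / 4]; total mass at most 1 forces
     [a 0 * INR k < 4]. *)
  - assert (D : forall i j, (i <= j)%nat -> a j <= a i).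
    { intros i j Hij; induction Hij as [|j Hij IH]; [lra|]; specialize (ad j); lra. }
    assert (L : rsum k (fun _ => a k) <= rsum k a) by (apply rsum_le; intros; apply D; lia).
    rewrite rsum_const in L; specialize (am k); nra.
Qed.

(** * Estimates for the transform *)

Lemma even_cv n rad G xi g X : symmetric_body n rad G -> (forall s, g (- s) = g s) ->
  Un_cv (fun k => gsum n k (half n G xi g)) X ->
  Un_cv (fun k => gsum n k (fun x => ind G x * g (dot n x xi)))
        (2 * X + - g 0 * vol n (slab n G xi (fun s => 0 <= s <= 0))).
Proof.
  intros HG He HX.
  apply (Un_cv_ext (fun k => 2 * gsum n k (half n G xi g) +
    - g 0 * gsum n k (ind (slab n G xi (fun s => 0 <= s <= 0))))).
  - intros k; symmetry; apply gsum_even; [apply (sb_opp _ _ _ HG)|exact He].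
  - apply CV_plus; (apply CV_mult; [apply Un_cv_const|]); [exact HX|].
    apply (vol_cv n rad), slab_cb; [apply HG|]; intros l s t Hl Hs Ht; nra.
Qed.

(** The hyperplane section need not be shown to be null: it lies in the central slab of any width,
    whose volume [central_slab_bound] makes small. *)
Lemma null_slab_bound n rad G xi dl : symmetric_body n rad G -> 0 < dl ->
  0 <= vol n (slab n G xi (fun s => 0 <= s <= 0)) <= slab_vol n G xi dl 0.
Proof.
  intros HG Hd.
  assert (C : convex_bounded n rad (slab n G xi (fun s => 0 <= s <= 0))).
  { apply slab_cb; [apply HG|]; intros l s t Hl Hs Ht; nra. }
  split; [exact (vol_nonneg n rad _ C)|].
  apply (vol_le n rad); [exact C|apply slab_cb, interval_co; apply HG|].
  intros x [Gx Hx]; split; [exact Gx|lra].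
Qed.

Lemma cos_2pi_lipschitz S0 : lipschitz_on S0 (2 * PI) (fun s => cos (2 * PI * s)).
Proof.
  intros s t _ _; eapply Rle_trans; [apply cos_lipschitz|].
  rewrite <- Rmult_minus_distr_l, Rabs_mult, (Rabs_pos_eq (2 * PI)); [lra|].
  pose proof PI_RGT_0; lra.
Qed.

Lemma cos_even_2pi s : cos (2 * PI * - s) = cos (2 * PI * s).
Proof. rewrite <- cos_neg; f_equal; ring. Qed.

Lemma half_cos_cv n rad G xi : symmetric_body n rad G ->
  exists X, Un_cv (fun k => gsum n k (half n G xi (fun s => cos (2 * PI * s)))) X.
Proof.
  intros HG; destruct (dot_bounded n rad G xi (sb_cb _ _ _ HG)) as [S0 [_ HS]].
  apply (half_cv n rad G xi _ S0 (2 * PI)); auto using cos_2pi_lipschitz.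
  pose proof PI_RGT_0; lra.
Qed.

Definition cos_transform n G xi := gint n (fun x => ind G x * cos (2 * PI * dot n x xi)).

Lemma cos_transform_cv n rad G xi : symmetric_body n rad G ->
  Un_cv (fun k => gsum n k (fun x => ind G x * cos (2 * PI * dot n x xi)))
        (cos_transform n G xi).
Proof.
  intros HG; destruct (half_cos_cv n rad G xi HG) as [X HX].
  assert (H := even_cv n rad G xi _ X HG cos_even_2pi HX); cbv beta in H.
  unfold cos_transform; rewrite (gint_eq _ _ _ H); exact H.
Qed.

Lemma cos_transform_decay n rad G xi sg : symmetric_body n rad G -> 0 < sg ->
  Un_cv (fun k => gsum n k (fun x => ind G x * (dot n x xi) ^ 2)) (sg ^ 2) ->
  Rabs (cos_transform n G xi) <= 25 / sg.
Proof.
  intros HG Hs HM.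
  assert (HM' : Un_cv (fun k => gsum n k (half n G xi (fun s => s ^ 2))) (sg ^ 2 / 2)).
  { apply (Un_cv_ext (fun k => / 2 * gsum n k (fun x => ind G x * (dot n x xi) ^ 2))).
    - intros k; rewrite (gsum_even n k G xi (fun s => s ^ 2)); [field|apply HG|intros; ring].
    - replace (sg ^ 2 / 2) with (/ 2 * sg ^ 2) by field.
      apply CV_mult; [apply Un_cv_const|exact HM]. }
  destruct (half_cos_cv n rad G xi HG) as [X HX].
  assert (H := even_cv n rad G xi _ X HG cos_even_2pi HX); cbv beta in H.
  unfold cos_transform; rewrite (gint_eq _ _ _ H), Rmult_0_r, cos_0; clear H.
  (* [k > sg] ensures [dl <= / 3]. [k > 6 sg^2 + 4 sg] makes the Riemann error
     [2 * (2 * PI * dl) <= 16 * dl] and the hyperplane term [4 / INR k] at most [/ sg] together,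
     since [16 * dl * INR k = 16 * sg / 3]. *)
  destruct (INR_unbounded (sg * (6 * sg + 4) + sg + 1)) as [k Hk].
  assert (Hk0 : 0 < INR k) by nra.
  assert (Hk1 : (0 < k)%nat) by (apply INR_lt; exact Hk0).
  assert (Ha := central_slab_bound n rad G xi sg k HG Hs HM' Hk1).
  set (dl := sg / (3 * INR k)) in *.
  assert (Hd : 0 < dl) by (apply Rdiv_lt_0_compat; lra).
  assert (Ek : dl * INR k = sg / 3) by (unfold dl; field; lra).
  assert (Hd3 : dl <= / 3) by nra.
  assert (N := null_slab_bound n rad G xi dl HG Hd).
  destruct (dot_bounded n rad G xi (sb_cb _ _ _ HG)) as [S0 [_ HS]].
  destruct (steps_beyond dl S0 Hd) as [m Hm]; specialize (Hm m (le_n _)).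
  assert (HP := PI_4); assert (HP0 := PI_RGT_0).
  assert (L := half_near n rad G HG xi dl Hd (fun s => cos (2 * PI * s)) (2 * PI) m S0 X HS Hm
    ltac:(lra) (cos_2pi_lipschitz S0) HX); cbv beta in L.
  set (a := fun i => slab_vol n G xi dl (dl * INR i)).
  assert (W := rsum_decr_mult_bound m a (fun i => cos (2 * PI * (dl * INR i))) (/ dl)
    ltac:(intros; apply (slab_vol_nonneg n rad), HG)
    ltac:(intros; apply (slab_seq_decr n rad); assumption)
    (fun j => sum_cos_bound dl j (conj Hd Hd3))).
  rewrite (rsum_ext m _ (fun i => cos (2 * PI * (dl * INR i)) * slab_vol n G xi dl (dl * INR i)))
    in W by (intros; unfold a; ring).
  replace (a 0%nat) with (slab_vol n G xi dl 0) in W by (unfold a; simpl; f_equal; ring).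
  assert (W2 : / dl * slab_vol n G xi dl 0 <= 12 / sg).
  { apply Rle_trans with (/ dl * (4 / INR k)).
    - apply Rmult_le_compat_l; [left; apply Rinv_0_lt_compat, Hd|exact Ha].
    - right; unfold dl; field; lra. }
  assert (Small : 16 * dl + 4 / INR k <= / sg).
  { apply Rmult_le_reg_r with (INR k * sg); [nra|].
    replace ((16 * dl + 4 / INR k) * (INR k * sg)) with (16 * (dl * INR k) * sg + 4 * sg)
      by (field; lra).
    rewrite Ek; replace (/ sg * (INR k * sg)) with (INR k) by (field; lra); nra. }
  assert (2 * PI * dl <= 8 * dl) by nra.
  unfold Rdiv in *; apply Rabs_bounds in L; apply Rabs_bounds in W; apply Rabs_le; lra.
Qed.

Lemma cos_transform_near_1 n rad G xi sg : symmetric_body n rad G -> 0 < sg ->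
  Un_cv (fun k => gsum n k (fun x => ind G x * (dot n x xi) ^ 2)) (sg ^ 2) ->
  Rabs (cos_transform n G xi - 1) <= 8 * sg.
Proof.
  intros HG Hs HM; assert (HP := PI_4); assert (HP0 := PI_RGT_0).
  assert (D := CV_minus _ _ _ _ (sb_vol _ _ _ HG) (cos_transform_cv n rad G xi HG)).
  assert (U := CV_plus _ _ _ _
    (CV_mult _ _ _ _ (Un_cv_const (PI / sg)) HM)
    (CV_mult _ _ _ _ (Un_cv_const (PI * sg)) (sb_vol _ _ _ HG))).
  assert (B : forall s, 0 <= 1 - cos (2 * PI * s) <= PI / sg * s ^ 2 + PI * sg).
  { intros s; pose proof (COS_bound (2 * PI * s)).
    assert (C := cos_lipschitz (2 * PI * s) 0); rewrite cos_0, Rminus_0_r in C.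
    rewrite Rabs_mult, (Rabs_pos_eq (2 * PI)) in C by lra; apply Rabs_bounds in C.
    assert (2 * Rabs s <= s ^ 2 / sg + sg).
    { apply Rmult_le_reg_r with sg; [exact Hs|].
      replace ((s ^ 2 / sg + sg) * sg) with (Rabs s ^ 2 + sg ^ 2)
        by (rewrite pow2_abs; field; lra).
      pose proof (pow2_ge_0 (Rabs s - sg)); nra. }
    assert (PI * (2 * Rabs s) <= PI * (s ^ 2 / sg + sg)) by (apply Rmult_le_compat_l; lra).
    unfold Rdiv in *; split; lra. }
  assert (E : forall k, gsum n k (ind G) - gsum n k (fun x => ind G x * cos (2 * PI * dot n x xi))
    = gsum n k (fun x => ind G x * (1 - cos (2 * PI * dot n x xi)))).
  { intros k.
    rewrite (gsum_ext n k (fun x => ind G x * (1 - cos (2 * PI * dot n x xi)))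
      (fun x => ind G x + -1 * (ind G x * cos (2 * PI * dot n x xi)))) by (intros; ring).
    rewrite gsum_plus, gsum_scal; ring. }
  assert (L1 : 0 <= 1 - cos_transform n G xi).
  { apply (Un_cv_le _ _ _ _ 0) with (2 := Un_cv_const 0) (3 := D).
    intros k _; rewrite E; apply gsum_nonneg; intros x.
    apply Rmult_le_pos; [apply ind_bounds|apply B]. }
  assert (L2 : 1 - cos_transform n G xi <= PI / sg * sg ^ 2 + PI * sg * 1).
  { apply (Un_cv_le _ _ _ _ 0) with (2 := D) (3 := U).
    intros k _; rewrite E, <- !gsum_scal, <- gsum_plus; apply gsum_le; intros x.
    specialize (B (dot n x xi)); pose proof (ind_bounds G x); nra. }
  replace (PI / sg * sg ^ 2 + PI * sg * 1) with (2 * PI * sg) in L2 by (field; lra).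
  assert (2 * PI * sg <= 8 * sg) by nra.
  apply Rabs_le; lra.
Qed.

(** [T] will be minus the radial derivative. The main term is scale invariant: [2 * PI * dl] from
    the integrand meets [2 * / dl] from the summation by parts, so the second moment does not
    enter. *)
Lemma radial_integral_bound n rad G xi : symmetric_body n rad G ->
  exists T, Rabs T <= 33 /\ Un_cv (fun k => gsum n k (fun x => ind G x *
    (2 * PI * dot n x xi * sin (2 * PI * dot n x xi)))) T.
Proof.
  intros HG; assert (HP := PI_4); assert (HP0 := PI_RGT_0).
  destruct (dot_bounded n rad G xi (sb_cb _ _ _ HG)) as [S0 [HS0 HS]].
  set (g := fun s => 2 * PI * s * sin (2 * PI * s)).
  set (K := 2 * PI * (1 + 2 * PI * S0)).
  assert (HK : 0 <= K) by (unfold K; nra).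
  assert (Lg : lipschitz_on S0 K g).
  { intros s t Hs Ht; unfold g.
    replace (2 * PI * s * sin (2 * PI * s) - 2 * PI * t * sin (2 * PI * t)) with
      (2 * PI * ((s - t) * sin (2 * PI * s) + t * (sin (2 * PI * s) - sin (2 * PI * t)))) by ring.
    rewrite Rabs_mult, (Rabs_pos_eq (2 * PI)) by lra.
    replace (K * Rabs (s - t)) with (2 * PI * ((1 + 2 * PI * S0) * Rabs (s - t)))
      by (unfold K; ring).
    apply Rmult_le_compat_l; [lra|].
    eapply Rle_trans; [apply Rabs_triang|]; rewrite !Rabs_mult.
    assert (A : Rabs (sin (2 * PI * s)) <= 1) by (apply Rabs_le, SIN_bound).
    assert (B := sin_lipschitz (2 * PI * s) (2 * PI * t)).
    rewrite <- Rmult_minus_distr_l, Rabs_mult, (Rabs_pos_eq (2 * PI)) in B by lra.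
    rewrite (Rabs_pos_eq t) by lra.
    pose proof (Rabs_pos (s - t)) as P.
    assert (Rabs (s - t) * Rabs (sin (2 * PI * s)) <= Rabs (s - t) * 1)
      by (apply Rmult_le_compat_l; assumption).
    assert (t * Rabs (sin (2 * PI * s) - sin (2 * PI * t)) <= S0 * (2 * PI * Rabs (s - t))).
    { apply Rmult_le_compat; try lra; apply Rabs_pos. }
    lra. }
  destruct (half_cv n rad G xi g S0 K HG HS HK Lg) as [X HX].
  assert (H := even_cv n rad G xi g X HG
    ltac:(intros s; unfold g; replace (2 * PI * - s) with (- (2 * PI * s)) by ring;
          rewrite sin_neg; ring) HX).
  replace (g 0) with 0 in H by (unfold g; ring).
  exists (2 * X); split; [|].
  2:{ replace (2 * X) with (2 * X + - 0 * vol n (slab n G xi (fun s => 0 <= s <= 0))) by ring.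
      exact H. }
  (* A fixed width is enough: a Riemann error of 1/2 gives 2 * (16 + 1/2) = 33, where 16 bounds
     [4 * PI]. *)
  set (dl := Rmin (/ 3) (/ (2 * (K + 1)))).
  assert (Hd : 0 < dl) by (apply Rmin_glb_lt; [lra|apply Rinv_0_lt_compat; lra]).
  assert (Hd3 : dl <= / 3) by apply Rmin_l.
  assert (HdK : K * dl <= / 2).
  { apply Rle_trans with (K * / (2 * (K + 1))).
    - apply Rmult_le_compat_l; [exact HK|apply Rmin_r].
    - apply Rmult_le_reg_r with (2 * (K + 1)); [lra|].
      rewrite Rmult_assoc, Rinv_l by lra; lra. }
  destruct (steps_beyond dl S0 Hd) as [m Hm]; specialize (Hm m (le_n _)).
  assert (L := half_near n rad G HG xi dl Hd g K m S0 X HS Hm HK Lg HX).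
  set (a := fun i => slab_vol n G xi dl (dl * INR i)).
  assert (W := rsum_index_mult_bound m a (fun i => sin (2 * PI * (dl * INR i))) (/ dl)
    ltac:(intros; apply (slab_vol_nonneg n rad), HG)
    ltac:(intros; apply (slab_seq_decr n rad); assumption)
    (fun j => sum_sin_bound dl j (conj Hd Hd3))).
  assert (M := slab_seq_mass n rad G HG xi dl Hd m); fold a in M.
  rewrite (rsum_ext m _ (fun i => 2 * PI * dl *
    (a i * (INR i * sin (2 * PI * (dl * INR i)))))) in L by (intros; unfold a, g; ring).
  rewrite rsum_scal in L.
  set (Q := rsum m (fun i => a i * (INR i * sin (2 * PI * (dl * INR i))))) in *.
  assert (id : 0 < / dl) by (apply Rinv_0_lt_compat, Hd).
  assert (WQ : Rabs Q <= 2 * / dl * 1).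
  { eapply Rle_trans; [exact W|]; apply Rmult_le_compat_l; lra. }
  assert (B : Rabs (2 * PI * dl * Q) <= 16).
  { rewrite Rabs_mult, (Rabs_pos_eq (2 * PI * dl)) by nra.
    apply Rle_trans with (2 * PI * dl * (2 * / dl * 1)).
    - apply Rmult_le_compat_l; [nra|exact WQ].
    - replace (2 * PI * dl * (2 * / dl * 1)) with (4 * PI) by (field; lra); lra. }
  apply Rabs_bounds in B; apply Rabs_bounds in L; apply Rabs_le; lra.
Qed.

(** One mean value step gives [- sin c * b] with [c] within [Rabs b] of [a], and [sin] is
    1-Lipschitz. *)
Lemma cos_taylor a b : Rabs (cos (a + b) - cos a + b * sin a) <= b ^ 2.
Proof.
  assert (M : exists c, Rabs (a - c) <= Rabs b /\ cos (a + b) - cos a = - sin c * b).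
  { destruct (Rtotal_order b 0) as [H|[H|H]].
    - destruct (MVT_cor2 cos (fun x => - sin x) (a + b) a ltac:(lra)) as [c [Hc Hc']].
      { intros; apply derivable_pt_lim_cos. }
      exists c; rewrite (Rabs_left b H); split; [apply Rabs_le; lra|lra].
    - exists a; subst b; rewrite Rplus_0_r, !Rminus_diag, Rabs_R0; lra.
    - destruct (MVT_cor2 cos (fun x => - sin x) a (a + b) ltac:(lra)) as [c [Hc Hc']].
      { intros; apply derivable_pt_lim_cos. }
      exists c; rewrite (Rabs_pos_eq b) by lra; split; [apply Rabs_le; lra|lra]. }
  destruct M as [c [Hc ->]].
  replace (- sin c * b + b * sin a) with (b * (sin a - sin c)) by ring.
  rewrite Rabs_mult, <- pow2_abs.
  pose proof (sin_lipschitz a c); pose proof (Rabs_pos b).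
  simpl; rewrite Rmult_1_r; apply Rmult_le_compat_l; lra.
Qed.

Lemma dot_upd n x xi i h : (i < n)%nat ->
  dot n x (upd xi i (xi i + h)) = dot n x xi + h * x i.
Proof.
  unfold dot, upd; induction n as [|n IH]; [lia|]; intros Hi; simpl.
  destruct (Nat.eq_dec i n) as [->|Hne].
  - rewrite Nat.eqb_refl.
    rewrite (rsum_ext n _ (fun j => x j * xi j)); [ring|].
    intros j Hj; destruct (Nat.eqb_spec j n); [lia|reflexivity].
  - rewrite IH by lia; destruct (Nat.eqb_spec n i); [lia|ring].
Qed.

(* Differentiation under the integral sign, phrased for the grid sums: the error of the
   difference quotient is O(h) uniformly in k. *)
Lemma partial_cv n rad G xi i l : symmetric_body n rad G -> (i < n)%nat ->
  derivable_pt_lim (fun t => cos_transform n G (upd xi i t)) (xi i) l ->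
  Un_cv (fun k => gsum n k (fun x => ind G x *
    (- (2 * PI * x i) * sin (2 * PI * dot n x xi)))) l.
Proof.
  intros HG Hi HD e He; assert (HP0 := PI_RGT_0).
  set (C := (2 * PI * rad) ^ 2).
  assert (HC : 0 <= C) by apply pow2_ge_0.
  destruct (HD (e / 4) ltac:(lra)) as [[dlt Hdlt] Hq]; simpl in Hq.
  (* [h] is fixed before [k]: the difference quotient is then within [e / 4] of [l] and the Taylor
     error [2 * C * h] is at most [e / 4]. Afterwards [k] brings both grid sums within [h * (e / 8)]
     of their limits, which costs another [e / 4] after division by [h]. *)
  set (h := Rmin (dlt / 2) (e / (8 * (C + 1)))).
  assert (Hh : 0 < h) by (apply Rmin_glb_lt; [|apply Rdiv_lt_0_compat]; lra).
  assert (Hhd : h < dlt) by (assert (h <= dlt / 2) by apply Rmin_l; lra).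
  assert (HhC : 2 * C * h <= e / 4).
  { apply Rle_trans with (2 * C * (e / (8 * (C + 1)))).
    - apply Rmult_le_compat_l; [lra|apply Rmin_r].
    - apply Rmult_le_reg_r with (8 * (C + 1)); [lra|].
      replace (2 * C * (e / (8 * (C + 1))) * (8 * (C + 1))) with (2 * C * e) by (field; lra); nra. }
  specialize (Hq h ltac:(lra) ltac:(rewrite Rabs_pos_eq; lra)).
  replace (upd xi i (xi i)) with xi in Hq.
  2:{ extensionality j; unfold upd; destruct (Nat.eqb_spec j i) as [->|]; reflexivity. }
  set (u1 := fun k => gsum n k (fun x => ind G x * cos (2 * PI * dot n x (upd xi i (xi i + h))))).
  set (u0 := fun k => gsum n k (fun x => ind G x * cos (2 * PI * dot n x xi))).
  set (D := fun k => gsum n k (fun x => ind G x *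
    (- (2 * PI * x i) * sin (2 * PI * dot n x xi)))).
  destruct (cos_transform_cv n rad G (upd xi i (xi i + h)) HG (h * (e / 8)) ltac:(nra)) as [N1 H1].
  destruct (cos_transform_cv n rad G xi HG (h * (e / 8)) ltac:(nra)) as [N2 H2].
  (* From [N3] on the grid volume of [G] is below 2, whence the factor 2 in [T]. *)
  destruct (sb_vol _ _ _ HG 1 ltac:(lra)) as [N3 H3].
  exists (N1 + N2 + N3)%nat; intros k Hk.
  specialize (H1 k ltac:(lia)); specialize (H2 k ltac:(lia)); specialize (H3 k ltac:(lia)).
  fold (u1 k) in H1; fold (u0 k) in H2.
  unfold Rdist in *; fold (D k).
  apply Rabs_def2 in H3.
  assert (T : Rabs (u1 k - u0 k - h * D k) <= C * h ^ 2 * 2).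
  { assert (P : forall x, Rabs (ind G x * cos (2 * PI * dot n x (upd xi i (xi i + h)))
      - ind G x * cos (2 * PI * dot n x xi)
      - h * (ind G x * (- (2 * PI * x i) * sin (2 * PI * dot n x xi)))) <= C * h ^ 2 * ind G x).
    { intros x; destruct (excluded_middle_informative (G x)) as [Gx|Gx].
      - rewrite ind_in, dot_upd by assumption.
        assert (Q := cos_taylor (2 * PI * dot n x xi) (2 * PI * (h * x i))).
        replace (1 * cos (2 * PI * (dot n x xi + h * x i)) - 1 * cos (2 * PI * dot n x xi) -
          h * (1 * (- (2 * PI * x i) * sin (2 * PI * dot n x xi)))) with
          (cos (2 * PI * dot n x xi + 2 * PI * (h * x i)) - cos (2 * PI * dot n x xi) +
           2 * PI * (h * x i) * sin (2 * PI * dot n x xi)).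
        2:{ replace (2 * PI * (dot n x xi + h * x i))
              with (2 * PI * dot n x xi + 2 * PI * (h * x i)) by ring; ring. }
        eapply Rle_trans; [exact Q|].
        assert (X := cb_bound _ _ _ (sb_cb _ _ _ HG) x i Hi Gx).
        assert (x i ^ 2 <= rad ^ 2).
        { rewrite <- (pow2_abs (x i)); apply pow_incr; split; [apply Rabs_pos|exact X]. }
        replace ((2 * PI * (h * x i)) ^ 2) with ((2 * PI) ^ 2 * h ^ 2 * x i ^ 2) by ring.
        replace (C * h ^ 2 * 1) with ((2 * PI) ^ 2 * h ^ 2 * rad ^ 2) by (unfold C; ring).
        apply Rmult_le_compat_l; [|assumption].
        apply Rmult_le_pos; apply pow2_ge_0.
      - rewrite ind_out by assumption.
        rewrite !Rmult_0_l, !Rmult_0_r, !Rminus_0_r, Rabs_R0; lra. }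
    assert (E : u1 k - u0 k - h * D k = gsum n k (fun x =>
      ind G x * cos (2 * PI * dot n x (upd xi i (xi i + h)))
      - ind G x * cos (2 * PI * dot n x xi)
      - h * (ind G x * (- (2 * PI * x i) * sin (2 * PI * dot n x xi))))).
    { rewrite (gsum_ext n k (fun x => _ - _ - _) (fun x =>
        ind G x * cos (2 * PI * dot n x (upd xi i (xi i + h)))
        + (-1 * (ind G x * cos (2 * PI * dot n x xi))
        + - h * (ind G x * (- (2 * PI * x i) * sin (2 * PI * dot n x xi)))))) by (intros; ring).
      rewrite !gsum_plus, !gsum_scal; unfold u1, u0, D; ring. }
    rewrite E.
    apply Rle_trans with (C * h ^ 2 * gsum n k (ind G)).
    - rewrite <- gsum_scal; apply Rabs_le; split.
      + rewrite <- (Ropp_involutive (gsum n k (fun x => _ - _ - _))).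
        apply Ropp_le_contravar.
        replace (- gsum n k (fun x => _)) with (-1 * gsum n k (fun x =>
          ind G x * cos (2 * PI * dot n x (upd xi i (xi i + h)))
          - ind G x * cos (2 * PI * dot n x xi)
          - h * (ind G x * (- (2 * PI * x i) * sin (2 * PI * dot n x xi))))) by ring.
        rewrite <- gsum_scal; apply gsum_le; intros x.
        specialize (P x); apply Rabs_bounds in P; lra.
      + apply gsum_le; intros x; specialize (P x); apply Rabs_bounds in P; lra.
    - apply Rmult_le_compat_l; [|lra]; apply Rmult_le_pos; [exact HC|apply pow2_ge_0]. }
  set (m1 := cos_transform n G (upd xi i (xi i + h))) in *.
  set (m0 := cos_transform n G xi) in *.
  apply Rabs_def2 in H1; apply Rabs_def2 in H2; apply Rabs_bounds in T; apply Rabs_def2 in Hq.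
  assert (Eq : (m1 - m0) / h * h = m1 - m0) by (field; lra).
  assert (T2 : C * h ^ 2 * 2 <= h * (e / 4)) by nra.
  apply Rabs_def1; apply Rmult_lt_reg_l with h; try exact Hh; nra.
Qed.

(** Both sides choose from the same predicate once the sums are identified, so the equality holds
    even where no limit exists. *)
Lemma Rd_int_gint n f : Rd_int n f = gint n f.
Proof.
  unfold Rd_int, gint, Rd_integral.
  replace (fun k => grid_sum n k f) with (fun k => gsum n k f); [reflexivity|].
  extensionality k; symmetry; apply grid_sum_gsum.
Qed.

(** The grids are symmetric, so every grid sum of the odd integrand is already 0. *)
Lemma sin_transform_zero n G xi : (forall x, G x -> G (fun i => - x i)) ->
  gint n (fun x => ind G x * sin (2 * PI * dot n x xi)) = 0.
Proof.
  intros Hs; apply gint_eq, (Un_cv_ext (fun _ => 0)); [|apply Un_cv_const].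
  intros k; set (f := fun x => ind G x * sin (2 * PI * dot n x xi)).
  assert (E : gsum n k f = -1 * gsum n k f); [|lra].
  rewrite <- gsum_scal, <- gsum_opp; apply gsum_ext; intros x; unfold f.
  rewrite dot_opp; replace (2 * PI * - dot n x xi) with (- (2 * PI * dot n x xi)) by ring.
  rewrite sin_neg.
  replace (ind G (fun i => - x i)) with (ind G x); [ring|].
  pose proof (opp_mem G x Hs) as Gx.
  unfold ind; do 2 destruct excluded_middle_informative; tauto.
Qed.

Lemma coord_le_enorm n x i : (i < n)%nat -> Rabs (x i) <= enorm n x.
Proof.
  intros Hi; unfold enorm; rewrite <- sqrt_Rsqr_abs; apply sqrt_le_1_alt.
  unfold dot, Rsqr; rewrite (rsum_split_at n i) by exact Hi.
  assert (0 <= rsum i (fun j => x (i - 1 - j)%nat * x (i - 1 - j)%nat))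
    by (apply rsum_nonneg; intros; apply Rle_0_sqr).
  assert (0 <= rsum (n - i - 1) (fun j => x (i + 1 + j)%nat * x (i + 1 + j)%nat))
    by (apply rsum_nonneg; intros; apply Rle_0_sqr).
  lra.
Qed.

Lemma enorm_pos n xi : inRd n xi -> xi <> zero_vec -> 0 < enorm n xi.
Proof.
  intros Hin Hne; destruct (sqrt_pos (dot n xi xi)) as [|E]; [assumption|exfalso].
  fold (enorm n xi) in E; apply Hne; extensionality i; unfold zero_vec.
  destruct (Nat.lt_ge_cases i n) as [Hi|Hi]; [|apply Hin, Hi].
  pose proof (coord_le_enorm n xi i Hi) as H; rewrite <- E in H.
  apply Rabs_bounds in H; lra.
Qed.

Lemma cmod_real a : cmod a 0 = Rabs a.
Proof.
  unfold cmod; rewrite <- sqrt_Rsqr_abs; f_equal; unfold Rsqr; ring.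
Qed.

Lemma symmetric_body_of n G L : convex_symmetric_body n G -> isotropic n G L ->
  exists rad, symmetric_body n rad G.
Proof.
  intros [_ [[R0 HR] [_ [Hc [_ Hs]]]]] [Hv _]; exists (Rabs R0); split; [split| |].
  - apply Rabs_pos.
  - intros x i Hi Gx; eapply Rle_trans; [apply (coord_le_enorm n x i Hi)|].
    eapply Rle_trans; [apply HR, Gx|apply Rle_abs].
  - intros l x y Hl Gx Gy; apply Hc; [assumption..|lra].
  - exact Hs.
  - apply (Un_cv_ext (fun k => grid_sum n k (ind G))); [intros; apply grid_sum_gsum|exact Hv].
Qed.

Theorem theorem2p3 (d : nat) (G : vec -> Prop) (L : R)
  (HG : convex_symmetric_body d G) (Hiso : isotropic d G L) :
  forall xi : vec, inRd d xi -> xi <> zero_vec ->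
    cmod (mG_re d G xi) (mG_im d G xi) <= 150 / (L * enorm d xi) /\
    cmod (mG_re d G xi - 1) (mG_im d G xi) <= 150 * (L * enorm d xi) /\
    (forall gr gi : nat -> R,
       (forall i, (i < d)%nat ->
          derivable_pt_lim (fun t => mG_re d G (upd xi i t)) (xi i) (gr i)) ->
       (forall i, (i < d)%nat ->
          derivable_pt_lim (fun t => mG_im d G (upd xi i t)) (xi i) (gi i)) ->
       cmod (dot d xi gr) (dot d xi gi) <= 150).
Proof.
  intros xi Hxi Hne.
  destruct (symmetric_body_of d G L HG Hiso) as [rad HB].
  destruct Hiso as [_ [HL Hm]].
  assert (Hs : 0 < L * enorm d xi) by (apply Rmult_lt_0_compat; [|apply enorm_pos]; assumption).
  set (sg := L * enorm d xi) in *.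
  assert (HM : Un_cv (fun k => gsum d k (fun x => ind G x * (dot d x xi) ^ 2)) (sg ^ 2)).
  { unfold sg; rewrite Rpow_mult_distr.
    apply Un_cv_ext with (2 := Hm xi Hxi); intros; apply grid_sum_gsum. }
  assert (Re : forall z, mG_re d G z = cos_transform d G z) by (intros; apply Rd_int_gint).
  assert (Im : forall z, mG_im d G z = 0).
  { intros; unfold mG_im; rewrite Rd_int_gint; apply sin_transform_zero, HB. }
  rewrite Re, Im, !cmod_real.
  assert (0 < / sg) by (apply Rinv_0_lt_compat, Hs).
  split; [|split].
  - eapply Rle_trans; [apply (cos_transform_decay d rad G xi sg); assumption|].
    unfold Rdiv; nra.
  - eapply Rle_trans; [apply (cos_transform_near_1 d rad G xi sg); assumption|]; nra.
  - intros gr gi Hr Hi.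
    assert (Zi : dot d xi gi = 0).
    { apply rsum_zero; intros i Hid.
      replace (gi i) with 0; [ring|].
      apply (uniqueness_limite (fun t => mG_im d G (upd xi i t)) (xi i)); [|apply Hi, Hid].
      replace (fun t => mG_im d G (upd xi i t)) with (fct_cte 0);
        [apply derivable_pt_lim_const|].
      extensionality t; symmetry; apply Im. }
    rewrite Zi, cmod_real.
    destruct (radial_integral_bound d rad G xi HB) as [T [HT HTc]].
    (* Two limits of one sequence. The integrands with a single [x i] do not depend on [dot d x xi]
       alone, so their convergence comes from the assumed partial derivatives via [partial_cv].
       Weighted by [xi i] and added, they become minus the radial integrand. *)
    assert (E : dot d xi gr = -1 * T).
    { apply (UL_sequence (fun k => rsum d (fun i => xi i * gsum d k (fun x => ind G x *
        (- (2 * PI * x i) * sin (2 * PI * dot d x xi)))))).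
      - assert (P : forall m, (m <= d)%nat -> Un_cv (fun k => rsum m (fun i => xi i *
          gsum d k (fun x => ind G x * (- (2 * PI * x i) * sin (2 * PI * dot d x xi)))))
          (rsum m (fun i => xi i * gr i))).
        { induction m as [|m IH]; intros Hmd; simpl; [apply Un_cv_const|].
          apply CV_plus; [apply IH; lia|].
          apply CV_mult; [apply Un_cv_const|].
          apply (partial_cv d rad); [exact HB|lia|].
          replace (fun t => cos_transform d G (upd xi m t))
            with (fun t => mG_re d G (upd xi m t)); [apply Hr; lia|].
          extensionality t; apply Re. }
        apply P; lia.
      - apply (Un_cv_ext (fun k => -1 * gsum d k (fun x => ind G x *
          (2 * PI * dot d x xi * sin (2 * PI * dot d x xi))))).
        + intros k; rewrite <- gsum_scal.
          rewrite (rsum_ext d _ (fun i => gsum d k (fun x => xi i * (ind G x *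
            (- (2 * PI * x i) * sin (2 * PI * dot d x xi)))))) by (intros; rewrite gsum_scal; reflexivity).
          rewrite <- gsum_rsum; apply gsum_ext; intros x.
          rewrite (rsum_ext d _ (fun i => (- (2 * PI) * ind G x * sin (2 * PI * dot d x xi)) *
            (x i * xi i))) by (intros; ring).
          rewrite rsum_scal; fold (dot d x xi); ring.
        + apply CV_mult; [apply Un_cv_const|exact HTc]. }
    rewrite E, Rabs_mult, (Rabs_left (-1)) by lra; lra.
Qed.
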